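(* Let $X\subset\mathbb{P}^n$ be a non-degenerate reduced projective scheme, let $d\ge 2$, and let $I\subset R=k[x_0,\ldots,x_n]$ be a homogeneous ideal defining $X$ scheme-theoretically and satisfying property $\mathbf{N}_{d,2}$. Let $\pi_q:X\to Y=\pi_q(X)\subset\mathbb{P}^{n-1}$ be the projection from a point $q\in\mathbb{P}^n\setminus X$, with coordinates chosen so that $q=(1:0:\cdots:0)$, let $K_i(I)\subset S_1=k[x_1,\ldots,x_n]$ be the $i$-th partial elimination ideal of $I$, and put $$Z_i=\{y\in\pi_q(X)\mid \pi_q^{-1}(y)\text{ has length}\ge i+1\}.$$ Then: (a) $K_{d-1}(I)$ is generated by at most linear forms (i.e. by forms of degree at most $1$). Thus $Z_{d-1}$ is either empty or a linear space. (b) $K_{d-2}(I)$ is generated by at most cubic forms (i.e. by forms of degree at most $3$). Thus $Z_{d-2}$ is either empty or cut out by at most cubic equations set-theoretically.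
   Context: The base field $k$ is algebraically closed of characteristic zero. A homogeneous ideal $I\subset R$ defines $X$ scheme-theoretically if its associated ideal sheaf is $\mathcal{I}_{X/\mathbb{P}^n}$ ($I$ need not be saturated). $I$ satisfies property $\mathbf{N}_{d,p}$ if $\mathrm{Tor}_i^R(R/I,k)$ is concentrated in degrees $<d+i$ for all $i\le p$. Partial elimination ideals: for the degree lexicographic order, if $f\in I$ has leading term $x_0^{d_0}\cdots x_n^{d_n}$, put $d_0(f)=d_0$ (leading power of $x_0$ in $f$). Let $\tilde K_i(I)=\bigoplus_{m\ge 0}\{f\in I_m\mid d_0(f)\le i\}$. Each $f\in\tilde K_i(I)$ is written uniquely as $f=x_0^i\bar f+g$ with $\bar f\in S_1$ and $d_0(g)<i$. $K_i(I)$ is the image of $\tilde K_i(I)$ in $S_1$ under $f\mapsto\bar f$. *)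

(* Defs.v *)
From HB Require Import structures.
From mathcomp Require Import all_boot all_order all_algebra.
From mathcomp.multinomials Require Import mpoly.

Set Implicit Arguments.
Unset Strict Implicit.
Unset Printing Implicit Defensive.

Import GRing.Theory.
Local Open Scope ring_scope.

Section Ideals.
Variables (k : fieldType) (n : nat).
Implicit Types (I G : {mpoly k[n]} -> Prop) (f : {mpoly k[n]}).

Definition ideal I : Prop :=
  [/\ I 0, (forall f g, I f -> I g -> I (f + g))
    & (forall a f, I f -> I (a * f))].

Definition hcomp (m : nat) f : {mpoly k[n]} := pihomog mdeg m f.

Definition homogeneous_ideal I : Prop :=
  ideal I /\ forall f, I f -> forall m, I (hcomp m f).

Definition ideal_gen G f : Prop :=
  forall A : {mpoly k[n]} -> Prop, ideal A -> (forall g, G g -> A g) -> A f.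

Definition generated_in_degrees_le I (m : nat) : Prop :=
  exists G : {mpoly k[n]} -> Prop,
    (forall g, G g -> exists2 e, (e <= m)%N & g \is e.-homog)
    /\ (forall f, I f <-> ideal_gen G f).

Definition saturated_ideal I : Prop :=
  forall f, (exists N, forall i : 'I_n, I ('X_i ^+ N * f)) -> I f.

Definition radical_ideal I : Prop := forall f N, I (f ^+ N) -> I f.

End Ideals.

(* A closed subscheme of P^n = Proj k[x_0, ..., x_n] is given by its saturated
   homogeneous ideal; the unit ideal gives the empty scheme. *)
Record proj_scheme (k : fieldType) (n : nat) := ProjScheme {
  ideal_of :> {mpoly k[n.+1]} -> Prop;
  ideal_of_homogeneous : homogeneous_ideal ideal_of;
  ideal_of_saturated : saturated_ideal ideal_of
}.

Section Sheaf.
Variables (k : fieldType) (n : nat).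
Implicit Types (I : {mpoly k[n.+1]} -> Prop) (X : proj_scheme k n).

(* Set x_j = 1; the other variables, in order, are the coordinates of the
   affine chart D_+(x_j) = A^n. *)
Definition dehomog (j : 'I_n.+1) (f : {mpoly k[n.+1]}) : {mpoly k[n]} :=
  f \mPo [tuple if unlift j i is Some l then 'X_l else 1 | i < n.+1].

(* Sections over D_+(x_j) of the ideal sheaf associated with I: the fractions
   f / x_j ^ m with f in I homogeneous of degree m. *)
Definition sheaf_on_chart I (j : 'I_n.+1) (g : {mpoly k[n]}) : Prop :=
  exists m f, [/\ I f, f \is m.-homog & g = dehomog j f].

Definition defines_scheme_theoretically I X : Prop :=
  forall j g, sheaf_on_chart I j g <-> sheaf_on_chart X j g.

(* The coordinate ring of X on each standard chart has no nilpotents. *)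
Definition scheme_reduced X : Prop := forall j, radical_ideal (sheaf_on_chart X j).

(* No hyperplane contains X: since X is saturated, the hyperplane l = 0 contains
   it exactly when l is in the ideal of X. *)
Definition scheme_nondegenerate X : Prop :=
  forall l : {mpoly k[n.+1]}, l \is 1.-homog -> X l -> l = 0.

End Sheaf.

(* Graded free resolutions ... -> F_1 -> F_0 -> R/I -> 0 over R = k[x_1..x_n],
   with F_i = (+)_l R(- gdeg i l), and maps v |-> v *m diff i on row vectors. *)
Record graded_free_resolution (k : fieldType) (n : nat)
    (I : {mpoly k[n]} -> Prop) := GradedFreeResolution {
  rk : nat -> nat;
  gdeg : forall i, 'I_(rk i) -> nat;
  diff : forall i, 'M[{mpoly k[n]}]_(rk i.+1, rk i);
  aug : 'cV[{mpoly k[n]}]_(rk 0);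
  (* all maps are homogeneous of degree 0 *)
  diff_homog : forall i a b (t : 'X_{1..n}),
    t \in msupp (diff i a b) -> (mdeg t + gdeg b = gdeg a)%N;
  aug_homog : forall a, aug a 0 \is (gdeg a).-homog;
  aug_surj : forall f, exists v : 'rV_(rk 0), I (f - (v *m aug) 0 0);
  exact0 : forall v : 'rV_(rk 0),
    I ((v *m aug) 0 0) <-> exists w, v = w *m diff 0;
  exactS : forall i (v : 'rV_(rk i.+1)),
    v *m diff i = 0 <-> exists w, v = w *m diff i.+1
}.

Section Tor.
Variables (k : fieldType) (n : nat) (I : {mpoly k[n]} -> Prop).
Variable F : graded_free_resolution I.

(* The complex F (x)_R k, where R -> k = R/(x_1..x_n) is the constant term. *)
Definition diff_k (i : nat) : 'M[k]_(rk F i.+1, rk F i) :=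
  map_mx (mcoeff 0%MM) (diff F i).

Definition in_degree (i j : nat) (v : 'rV[k]_(rk F i)) : Prop :=
  forall l, v 0 l != 0 -> gdeg l = j.

Definition tor_cycle (i : nat) : 'rV[k]_(rk F i) -> Prop :=
  match i with
  | 0 => fun _ => True
  | i'.+1 => fun v => v *m diff_k i' = 0
  end.

(* Tor_i(R/I, k)_j = H_i(F (x) k)_j = 0 *)
Definition tor_vanishes (i j : nat) : Prop :=
  forall v, in_degree j v -> tor_cycle v ->
    exists2 w : 'rV_(rk F i.+1), in_degree j w & v = w *m diff_k i.

End Tor.

(* Tor does not depend on the resolution used to compute it, and a resolution
   by finitely generated graded free modules always exists. *)
Definition property_N (k : fieldType) (n : nat) (d p : nat)
    (I : {mpoly k[n]} -> Prop) : Prop :=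
  exists F : graded_free_resolution I,
    forall i j, (i <= p)%N -> (d + i <= j)%N -> tor_vanishes F i j.

Section PartialElimination.
Variables (k : fieldType) (n : nat) (I : {mpoly k[n.+1]} -> Prop).

(* [mlead] is taken for the degree lexicographic order with x_0 > x_1 > ... *)
Definition lead_x0 (f : {mpoly k[n.+1]}) : nat := mlead f ord0.

Definition elim_tilde (i : nat) (f : {mpoly k[n.+1]}) : Prop :=
  forall m, I (hcomp m f) /\ (lead_x0 (hcomp m f) <= i)%N.

(* S_1 = k[x_1..x_n] inside R = k[x_0..x_n]; the variable of S_1 with index j
   is x_(j+1). *)
Definition embed_S1 (h : {mpoly k[n]}) : {mpoly k[n.+1]} :=
  h \mPo [tuple 'X_(lift ord0 j) | j < n].

(* f = x_0^i h + g, where g only involves powers of x_0 smaller than i (so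
   g = 0 when i = 0). *)
Definition partial_elim (i : nat) (h : {mpoly k[n]}) : Prop :=
  exists f g, [/\ elim_tilde i f, f = 'X_ord0 ^+ i * embed_S1 h + g
    & forall t, t \in msupp g -> (t ord0 < i)%N].

End PartialElimination.

(* Points of projective space are represented by nonzero vectors of homogeneous
   coordinates, and subsets of P^n by the cones over them. *)
Section Projection.
Variables (k : fieldType) (n : nat) (X : proj_scheme k n).

Definition point_of (x : 'rV[k]_n.+1) : Prop :=
  x != 0 /\ forall f, X f -> f.@[fun i => x 0 i] = 0.

(* q = (1 : 0 : ... : 0) *)
Definition proj_center : 'rV[k]_n.+1 := delta_mx 0 ord0.

Definition lin_proj (x : 'rV[k]_n.+1) : 'rV[k]_n := \row_j x 0 (lift ord0 j).

Definition proj_image (y : 'rV[k]_n) : Prop :=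
  y != 0 /\ exists2 x, point_of x & lin_proj x = y.

(* The scheme-theoretic fibre of the projection P^n \ {q} -> P^(n-1) over y is
   the affine line { (t : y_1 : ... : y_n) }.  When q is not in X, the fibre of
   X over y is the closed subscheme of this line, with coordinate t, whose ideal
   is obtained by restricting the ideal of X. *)
Definition restrict_line (y : 'rV[k]_n) (f : {mpoly k[n.+1]}) : {poly k} :=
  mmap polyC (fun i => if unlift ord0 i is Some j then (y 0 j)%:P else 'X) f.

Definition fibre_ideal (y : 'rV[k]_n) (g : {poly k}) : Prop :=
  exists2 f, X f & g = restrict_line y f.

(* dim_k k[t]/A >= m *)
Definition colength_ge (A : {poly k} -> Prop) (m : nat) : Prop :=
  exists v : 'I_m -> {poly k},
    forall c : 'I_m -> k, A (\sum_i c i *: v i) -> forall i, c i = 0.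

Definition multiple_locus (i : nat) (y : 'rV[k]_n) : Prop :=
  proj_image y /\ colength_ge (fibre_ideal y) i.+1.

End Projection.

Section Loci.
Variables (k : fieldType) (n : nat) (Z : 'rV[k]_n -> Prop).

Definition empty_locus : Prop := forall y, ~ Z y.

(* Z = P(W) with W a nonzero linear subspace of k^n. *)
Definition linear_locus : Prop :=
  exists2 W : {vspace 'rV[k]_n}, (0 < \dim W)%N
    & forall y, y != 0 -> (Z y <-> y \in W).

Definition cut_out_in_degrees_le (m : nat) : Prop :=
  exists2 s : seq {mpoly k[n]},
    (forall f, f \in s -> exists2 e, (e <= m)%N & f \is e.-homog)
    & forall y, y != 0 ->
        (Z y <-> forall f, f \in s -> f.@[fun i => y 0 i] = 0).

End Loci.

(* Main.v *)
From HB Require Import structures.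
Require Import Defs.
From mathcomp Require Import all_boot all_order all_algebra.
From mathcomp.multinomials Require Import mpoly.
From mathcomp Require Import ring.
From Stdlib Require Import Classical.

(** Write R = k[x_0..x_n], S = k[x_1..x_n], J = (x_1, .., x_n), and let M_i be
    the S-module of the f in I whose x_0-degree is less than i; then K_i(I) is
    the module of coefficients of x_0^i of the elements of M_(i+1).

    Property N_{d,2} is used through two consequences, read off by chasing
    elements through a graded free resolution and the Koszul complex: an
    element of I of degree > d lies in (x_0, .., x_n) I ([tor1_generation]), and
    an element f of I of degree > d with x_0 f in J I lies in J I
    ([tor2_regularity]).  The first, together with q not in X, yields a form F
    in I of degree d that is monic in x_0 ([monic_of_point_notin]).  Since
    F = x_0^d modulo J, every f in I satisfies x_0^d f = F f modulo J I; the
    second consequence cancels the powers of x_0 one at a time and gives that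
    every f in I of degree > d lies in F R + J I ([mod_monic_and_vars]).
    Dividing by F, an element of M_d of degree > d is a combination of elements
    of M_d with coefficients x_1, .., x_n ([elim_module_step]), so M_d is
    generated over S in degrees at most d.  Taking coefficients of x_0^(d-1),
    K_(d-1) is generated in degrees at most 1.

    For K_(d-2), write f in M_(d-1) as a combination of generators of M_d.  The
    coefficients of x_0^(d-1) give a syzygy among forms of degree at most 1, and
    such forms generate either the unit ideal or a prime ideal with a linear
    section, so that the syzygies are generated by Koszul ones and by those that
    express one form through the others ([syzygies_span]).  Each of them produces an element of M_(d-1) of degree at
    most d+1; hence the bound d + 1 - (d - 2) = 3.

    Finally, for y in P^(n-1), the fibre of X over y is defined in the line
    k[t] by the restrictions of the elements of I, as I and the ideal of X agree
    up to powers of a variable that does not vanish at y ([fibre_idealE]).  The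
    fibre has length > i exactly when no nonzero restriction has degree <= i
    ([multiple_locusP]).  A nonzero restriction of degree <= i can be shifted by
    a power of t to degree i, and reduction modulo F makes it the restriction of
    an element of M_(i+1), whose coefficient of x_0^i does not vanish at y;
    hence Z_i is the zero locus of K_i for i = d-1 and, with one more
    elimination step, for i = d-2 ([multiple_locus_first],
    [multiple_locus_second]). *)

Set Implicit Arguments.
Unset Strict Implicit.
Unset Printing Implicit Defensive.

Import GRing.Theory.
Local Open Scope ring_scope.

(** * Ideals, homogeneous components and Koszul relations *)

Section Graded.
Variables (k : fieldType) (n : nat).
Implicit Types (f g a : {mpoly k[n]}) (I A : {mpoly k[n]} -> Prop).

Lemma ideal_sum A (T : Type) (s : seq T) (P : pred T) (F : T -> {mpoly k[n]}) :
  ideal A -> (forall i, P i -> A (F i)) -> A (\sum_(i <- s | P i) F i).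
Proof. by move=> [A0 AD _] AF; apply: big_ind. Qed.

Lemma idealN A f : ideal A -> A f -> A (- f).
Proof. by move=> [_ _ AM] Af; rewrite -mulN1r; apply: AM. Qed.

Lemma idealB A f g : ideal A -> A f -> A g -> A (f - g).
Proof. by move=> iA Af Ag; case: (iA) => _ AD _; apply: AD => //; apply: idealN. Qed.

Lemma idealZ A c f : ideal A -> A f -> A (c *: f).
Proof. by move=> [_ _ AM] Af; rewrite -mul_mpolyC; apply: AM. Qed.

Lemma hcompM m e c f : c \is e.-homog ->
  hcomp m (c * f) = if (e <= m)%N then c * hcomp (m - e) f else 0.
Proof.
move=> hc; rewrite {1}(pihomog_partitionE (leqnn (mmeasure mdeg f))).
rewrite mulr_sumr /hcomp linear_sum /=.
have part i : pihomog mdeg m (c * pihomog mdeg i f) =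
    if (e + i == m)%N then c * pihomog mdeg i f else 0.
  have hci := dhomogM hc (pihomogP mdeg i f).
  by case: eqP => [<-|/eqP ne]; [rewrite pihomog_dE | rewrite (pihomog_ne0 ne)].
under eq_bigr do rewrite part.
case: leqP => [le_em|lt_me]; last first.
  by rewrite big1 // => i _; case: eqP => // eq; move: lt_me; rewrite -eq -ltn_subRL subnn.
have [lt|ge] := ltnP (m - e) (mmeasure mdeg f).
  rewrite (bigD1 (Ordinal lt)) //= subnKC // eqxx big1 ?addr0 //.
  move=> i /eqP ne; case: eqP => // eq; case: ne; apply/val_inj => /=.
  by rewrite -eq addKn.
rewrite big1 => [|i _]; last first.
  case: eqP => // eq; move: ge; rewrite -eq addKn leqNgt.
  by rewrite (ltn_ord i).
rewrite pihomogE big_seq_cond big1 ?mulr0 // => t /andP[ts /eqP tm].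
by have := mmeasure_mnm_lt mdeg ts; rewrite tm ltnNge ge.
Qed.

Lemma Xn_homog (i : 'I_n) e : ('X_i ^+ e : {mpoly k[n]}) \is e.-homog.
Proof. by rewrite -{2}[e]mul1n; apply: dhomogMn; rewrite dhomogX /= mdeg1. Qed.

Lemma hcompX0 i f : hcomp 0 ('X_i * f) = 0.
Proof. by rewrite (@hcompM 0 1) // dhomogX /= mdeg1. Qed.

Lemma hcompXS m i f : hcomp m.+1 ('X_i * f) = 'X_i * hcomp m f.
Proof. by rewrite (@hcompM _ 1) ?subn1 // dhomogX /= mdeg1. Qed.

Lemma mcoeff_hcomp m f t : (hcomp m f)@_t = if mdeg t == m then f@_t else 0.
Proof.
rewrite /hcomp pihomogE linear_sum /= -big_filter.
set s := [seq u <- _ | _]; have us : uniq s by rewrite filter_uniq.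
have F0 u : u != t -> (f@_u *: 'X_[u])@_t = 0.
  by move=> /negbTE ne; rewrite mcoeffZ mcoeffX ne mulr0.
have [ts|nts] := boolP (t \in s).
  rewrite (bigD1_seq t) //= big1 ?addr0 => [|u ne]; last exact: F0.
  by move: ts; rewrite mem_filter mcoeffZ mcoeffX eqxx mulr1 => /andP[-> _].
rewrite big_seq big1 => [|u us']; last first.
  by apply: F0; apply: contraNneq nts => <-.
move: nts; rewrite mem_filter; case: eqP => //= _ /memN_msupp_eq0 //.
Qed.

Lemma hcomp_sum f : f = \sum_(m < msize f) hcomp m f.
Proof. exact: (pihomog_partitionE (leqnn _)). Qed.

Lemma homogeneous_idealE I f : homogeneous_ideal I ->
  (forall m, I (hcomp m f)) -> I f.
Proof. by move=> [iI _] h; rewrite (hcomp_sum f); apply: ideal_sum. Qed.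

(** For an ideal I, its product with the ideal generated by the variables of
    r. *)
Definition var_comb (r : seq 'I_n) I f : Prop :=
  exists2 h : 'I_n -> {mpoly k[n]}, (forall i, I (h i))
    & f = \sum_(i <- r) 'X_i * h i.

Lemma var_comb_ideal r I : ideal I -> ideal (var_comb r I).
Proof.
move=> [I0 ID IM]; split.
- by exists (fun=> 0) => //; rewrite big1 // => i; rewrite mulr0.
- move=> f g [u Iu ->] [v Iv ->]; exists (fun i => u i + v i); first by auto.
  by rewrite -big_split; apply: eq_bigr => i _; rewrite mulrDr.
- move=> a f [u Iu ->]; exists (fun i => a * u i); first by auto.
  by rewrite mulr_sumr; apply: eq_bigr => i _; rewrite mulrCA.
Qed.

Lemma var_combX r I i f : ideal I -> uniq r -> i \in r -> I f ->
  var_comb r I ('X_i * f).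
Proof.
move=> [I0 _ _] ur ir If; exists (fun j => if j == i then f else 0).
  by move=> j; case: ifP.
rewrite (bigD1_seq i) //= eqxx big1 ?addr0 // => j /negbTE ->.
by rewrite mulr0.
Qed.

(** A substitution that is the identity modulo A on the variables is the
    identity modulo A everywhere; so an ideal is the kernel of any such
    substitution that vanishes on it. *)
Lemma comp_mpoly_mod A (l : n.-tuple {mpoly k[n]}) f : ideal A ->
  (forall i, A ('X_i - tnth l i)) -> A (f - (f \mPo l)).
Proof.
move=> iA Al; have [A0 AD AM] := iA.
have prod (F G : 'I_n -> {mpoly k[n]}) (s : seq 'I_n) :
    (forall i, A (F i - G i)) -> A (\prod_(i <- s) F i - \prod_(i <- s) G i).
  move=> FG; elim: s => [|i s IHs]; first by rewrite !big_nil subrr.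
  rewrite !big_cons.
  have -> : F i * \prod_(j <- s) F j - G i * \prod_(j <- s) G j =
     (\prod_(j <- s) F j) * (F i - G i)
     + G i * (\prod_(j <- s) F j - \prod_(j <- s) G j) by ring.
  by apply: AD; apply: AM.
have pow (a b : {mpoly k[n]}) e : A (a - b) -> A (a ^+ e - b ^+ e).
  by move=> Aab; rewrite subrXX mulrC; apply: AM.
rewrite [f \mPo l]comp_mpolyEX {1}[f]mpolyE -sumrB.
apply: ideal_sum => // t _; rewrite -scalerBr; apply: idealZ => //.
by rewrite comp_mpolyX mpolyXE_id; apply: prod => i; apply: pow.
Qed.

Definition kill_vars (r : seq 'I_n) : n.-tuple {mpoly k[n]} :=
  [tuple if i \in r then 0 else 'X_i | i < n].

Lemma var_comb_mPo I r f : var_comb r I f -> f \mPo (kill_vars r) = 0.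
Proof.
case=> h _ ->; rewrite linear_sum big_seq big1 //= => i ir.
by rewrite rmorphM /= comp_mpolyXU -tnth_nth tnth_mktuple ir mul0r.
Qed.

Lemma mPo_var_comb r f : uniq r ->
  f \mPo (kill_vars r) = 0 -> var_comb r (fun=> True) f.
Proof.
move=> ur f0; rewrite -[f]subr0 -f0; apply: comp_mpoly_mod => [|i].
  exact: var_comb_ideal.
rewrite tnth_mktuple; case: ifP => ir; last first.
  rewrite subrr; exists (fun=> 0) => //.
  by rewrite big1 // => j; rewrite mulr0.
by rewrite subr0 -['X_i]mulr1; apply: var_combX.
Qed.

(** The variables of r generate a prime ideal, the kernel of [kill_vars r]. *)
Lemma var_comb_regular r i f : uniq r -> i \notin r ->
  var_comb r (fun=> True) ('X_i * f) -> var_comb r (fun=> True) f.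
Proof.
move=> ur ir /var_comb_mPo; rewrite rmorphM /= comp_mpolyXU -tnth_nth.
rewrite tnth_mktuple (negbTE ir) => /eqP; rewrite mulf_eq0 => /orP[/eqP X0|].
  by have := mcoeffXU k i i; rewrite X0 mcoeff0 eqxx => /esym/eqP; rewrite oner_eq0.
by move/eqP; apply: mPo_var_comb.
Qed.

(** Koszul relations are written with an arbitrary square array c, whose
    antisymmetrization c i j - c j i gives the coefficients. *)
Lemma koszul_cancel (r : seq 'I_n) (c : 'I_n -> 'I_n -> {mpoly k[n]}) :
  \sum_(i <- r) 'X_i * (\sum_(j <- r) 'X_j * (c i j - c j i)) = 0.
Proof.
have -> : \sum_(i <- r) 'X_i * (\sum_(j <- r) 'X_j * (c i j - c j i)) =
  \sum_(i <- r) \sum_(j <- r) 'X_i * 'X_j * c i j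
  - \sum_(i <- r) \sum_(j <- r) 'X_i * 'X_j * c j i.
  rewrite -sumrB; apply: eq_bigr => i _; rewrite mulr_sumr -sumrB.
  by apply: eq_bigr => j _; ring.
rewrite [X in _ - X]exchange_big /= -sumrB big1 // => i _.
by rewrite -sumrB big1 // => j _; ring.
Qed.

(** Exactness of the Koszul complex of the variables in degree one: each
    coefficient of a relation lies in the ideal of the other variables, so
    Koszul relations remove one term of the relation at a time. *)
Lemma koszul_exact (r : seq 'I_n) (a : 'I_n -> {mpoly k[n]}) : uniq r ->
  \sum_(i <- r) 'X_i * a i = 0 ->
  exists c : 'I_n -> 'I_n -> {mpoly k[n]}, forall i, i \in r ->
    a i = \sum_(j <- r) 'X_j * (c i j - c j i).
Proof.
elim: r a => [|i r IHr] a /=; first by exists (fun _ _ => 0).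
case/andP=> ir ur; rewrite big_cons => sa.
have [b _ ai] : var_comb r (fun=> True) (a i).
  apply: (var_comb_regular ur ir); exists (fun j => - a j) => //.
  move/eqP: sa; rewrite addr_eq0 => /eqP ->; rewrite -sumrN.
  by apply: eq_bigr => j _; rewrite mulrN.
have /IHr-/(_ ur) [c ac] : \sum_(j <- r) 'X_j * (a j + 'X_i * b j) = 0.
  rewrite -[RHS]sa ai mulr_sumr addrC -big_split; apply: eq_bigr => j _ /=.
  by ring.
exists (fun u v => if u == i then (if v == i then 0 else b v)
                   else if v == i then 0 else c u v) => l.
rewrite inE big_cons !eqxx => /orP[/eqP -> | lr].
  rewrite !eqxx subrr mulr0 add0r {1}ai !big_seq; apply: eq_bigr => j jr.
  by case: eqP => [e | _]; [rewrite -e jr in ir | rewrite subr0].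
have /negbTE li : l != i by apply: contraNneq ir => <-.
rewrite li sub0r.
have -> : \sum_(j <- r) 'X_j * ((if j == i then 0 else c l j) -
     (if j == i then if false then 0 else b l else c j l)) =
     \sum_(j <- r) 'X_j * (c l j - c j l).
  rewrite !big_seq; apply: eq_bigr => j jr.
  by case: eqP => [e | _] //; rewrite -e jr in ir.
by rewrite -ac //; ring.
Qed.

Lemma const0_var_comb f : f@_0%MM = 0 -> var_comb (enum 'I_n) (fun=> True) f.
Proof.
move=> f0; apply: mPo_var_comb; first exact: enum_uniq.
rewrite comp_mpolyEX big1_seq // => t /= tf.
have [t0|] := eqVneq t 0%MM; first by rewrite t0 f0 scale0r.
rewrite -mdeg_eq0 mdegE sum_nat_eq0 negb_forall => /existsP[i /= ti].
rewrite comp_mpolyX (bigD1 i) //= tnth_mktuple mem_enum expr0n.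
by rewrite (negbTE ti) mul0r scaler0.
Qed.

Lemma homog0E f : f \is 0.-homog -> f = (f@_0%MM)%:MP.
Proof.
move=> fh; apply/mpolyP => u; rewrite mcoeffC.
have [->|ne] := eqVneq u 0%MM; first by rewrite mulr1.
by rewrite mulr0; apply: (dhomog_nemf_coeff fh); rewrite /= mdeg_eq0.
Qed.

End Graded.

(** * Consequences of the vanishing of Tor_1 and Tor_2 *)

Section Resolution.
Variables (k : fieldType) (n : nat) (I : {mpoly k[n]} -> Prop).
Hypothesis I_hom : homogeneous_ideal I.
Variable F : graded_free_resolution I.
Implicit Types (f g : {mpoly k[n]}) (r : seq 'I_n).

Let iI : ideal I. Proof. by case: I_hom. Qed.

Definition augf (p : 'rV[{mpoly k[n]}]_(rk F 0)) := (p *m aug F) 0 0.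

Lemma augfB p q : augf (p - q) = augf p - augf q.
Proof. by rewrite /augf mulmxBl !mxE. Qed.

Lemma augfZ c p : augf (c *: p) = c * augf p.
Proof. by rewrite /augf -scalemxAl mxE. Qed.

Lemma augf_sum (T : Type) (s : seq T) (G : T -> 'rV_(rk F 0)) :
  augf (\sum_(i <- s) G i) = \sum_(i <- s) augf (G i).
Proof. by rewrite /augf mulmx_suml summxE. Qed.

Lemma augf_diff u : I (augf (u *m diff F 0)).
Proof. by rewrite /augf; apply/exact0; exists u. Qed.

(** If a lift of a relation f = sum x_i g_i to F_0 is a combination of the
    variables with values in the image of F_1, then it differs from that
    combination by a Koszul relation, which f does not see; what is left of the
    g_i lies in I. *)
Lemma koszul_lift r (g : 'I_n -> {mpoly k[n]}) p u : uniq r ->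
  (forall i, I (g i - augf (p i))) ->
  \sum_(i <- r) 'X_i *: p i = \sum_(i <- r) 'X_i *: (u i *m diff F 0) ->
  var_comb r I (\sum_(i <- r) 'X_i * g i).
Proof.
move=> ur gp pu.
have /fin_all_exists [c cP] : forall a : 'I_(rk F 0), exists c : 'I_n -> 'I_n -> {mpoly k[n]},
    forall i, i \in r ->
      (p i - u i *m diff F 0) 0 a = \sum_(j <- r) 'X_j * (c i j - c j i).
  move=> a; apply: koszul_exact => //.
  have /matrixP/(_ 0 a) : \sum_(i <- r) 'X_i *: (p i - u i *m diff F 0) = 0.
    under eq_bigr do rewrite scalerBr.
    by rewrite sumrB pu subrr.
  rewrite summxE [RHS]mxE => e; rewrite -[RHS]e; apply: eq_bigr => i _.
  by rewrite [RHS]mxE.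
pose q i j := \row_a c a i j.
have pq i : i \in r -> p i - u i *m diff F 0 = \sum_(j <- r) 'X_j *: (q i j - q j i).
  move=> ir; apply/rowP => a; rewrite cP // summxE; apply: eq_bigr => j _.
  by rewrite !mxE.
pose e i := \sum_(j <- r) 'X_j * (augf (q i j) - augf (q j i)).
exists (fun i => if i \in r then g i - e i else 0).
  move=> i; case: ifP => ir; last by case: iI.
  have -> : e i = augf (p i) - augf (u i *m diff F 0).
    rewrite -augfB pq // augf_sum; apply: eq_bigr => j _.
    by rewrite augfZ augfB.
  rewrite opprB addrCA; case: iI => _ ID _; apply: ID => //.
  exact: augf_diff.
rewrite -[LHS]subr0 -[X in _ - X](koszul_cancel r (fun i j => augf (q i j))).
rewrite -sumrB !big_seq; apply: eq_bigr => i ir.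
by rewrite ir mulrBr.
Qed.

(** The degree-m component of an element of F_i, where the basis vector l has
    degree [gdeg l]. *)
Definition hrow i m (v : 'rV[{mpoly k[n]}]_(rk F i)) : 'rV[{mpoly k[n]}]_(rk F i) :=
  \row_l (if (gdeg l <= m)%N then hcomp (m - gdeg l) (v 0 l) else 0).
Arguments hrow : clear implicits.

Lemma hrowX i m j v : hrow i m.+1 ('X_j *: v) = 'X_j *: hrow i m v.
Proof.
apply/rowP => l; rewrite !mxE.
case: (ltngtP (gdeg l) m.+1) => [| lt | ->].
- by rewrite ltnS => le; rewrite le subSn // hcompXS.
- by rewrite leqNgt (ltnW lt) /= mulr0.
- by rewrite ltnn subnn mulr0 hcompX0.
Qed.

Lemma hrowB i m u v : hrow i m (u - v) = hrow i m u - hrow i m v.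
Proof.
by apply/rowP => l; rewrite !mxE; case: ifP; rewrite ?subr0 // => _; apply: raddfB.
Qed.

Lemma hrow_sum i m (T : Type) (s : seq T) G :
  hrow i m (\sum_(t <- s) G t) = \sum_(t <- s) hrow i m (G t).
Proof.
elim: s => [|t s IHs]; rewrite ?big_nil ?big_cons.
  by apply/rowP => l; rewrite !mxE /hcomp pihomog0 if_same.
have := @hrowB i m (G t + \sum_(j <- s) G j) (\sum_(j <- s) G j).
by rewrite addrK IHs => ->; rewrite subrK.
Qed.

Lemma hrow_id i m v : hrow i m (hrow i m v) = hrow i m v.
Proof.
apply/rowP => l; rewrite !mxE; case: (gdeg l <= m)%N => //.
exact: pihomog_id.
Qed.

(** Common form of the compatibility of [hrow] with [diff] and [aug]: D is one
    column of the matrix of a map of degree zero, onto a generator of degree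
    e. *)
Lemma hrow_mul (e : nat) i m (D : 'cV[{mpoly k[n]}]_(rk F i)) v :
  (forall a (t : 'X_{1..n}), t \in msupp (D a 0) -> (mdeg t + e = gdeg a)%N) ->
  (if (e <= m)%N then hcomp (m - e) ((v *m D) 0 0) else 0) =
  (hrow i m v *m D) 0 0.
Proof.
move=> hD; rewrite !mxE.
have -> : (if (e <= m)%N then hcomp (m - e) (\sum_j v 0 j * D j 0) else 0) =
   \sum_j (if (e <= m)%N then hcomp (m - e) (v 0 j * D j 0) else 0).
  by case: ifP => _; [rewrite /hcomp linear_sum | rewrite big1].
apply: eq_bigr => a _; rewrite mxE.
have [-> | Dn0] := eqVneq (D a 0) 0.
  by rewrite !mulr0 /hcomp pihomog0 if_same.
have le_ea : (e <= gdeg a)%N.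
  by rewrite -(hD _ _ (mlead_supp Dn0)) leq_addl.
have Dh : D a 0 \is (gdeg a - e).-homog.
  by apply/dhomogP => t /hD <-; rewrite addnK.
rewrite mulrC (hcompM _ _ Dh).
have [le_em|lt_me] := leqP e m; last first.
  by rewrite leqNgt (leq_trans lt_me) // mul0r.
rewrite leq_sub2rE //; case: ifP => _; last by rewrite mul0r.
by rewrite mulrC subnBA // subnK.
Qed.

Lemma hrow_diff i m v : hrow i m (v *m diff F i) = hrow i.+1 m v *m diff F i.
Proof.
have col_diff b (u : 'rV_(rk F i.+1)) :
    (u *m diff F i) 0 b = (u *m \col_a diff F i a b) 0 0.
  by rewrite !mxE; apply: eq_bigr => a _; rewrite mxE.
apply/rowP => b; rewrite mxE !col_diff.
by apply: hrow_mul => a t; rewrite mxE; apply: diff_homog.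
Qed.

Lemma hrow_aug m p : augf (hrow 0 m p) = hcomp m (augf p).
Proof.
have := @hrow_mul 0 0 m (aug F) p; rewrite leq0n subn0 => -> // a t ts.
by rewrite addn0; move/dhomogP: (aug_homog a); apply.
Qed.

(** Vanishing of Tor in degree m, lifted from the complex over k to the
    resolution: a homogeneous element whose image is zero modulo the variables
    is, modulo the variables, a boundary. *)
Lemma tor_lift i m w : tor_vanishes F i.+1 m ->
  w = hrow i.+1 m w -> map_mx (mcoeff 0%MM) (w *m diff F i) = 0 ->
  exists w' u, w = w' *m diff F i.+1 + \sum_(x : 'I_n) 'X_x *: u x.
Proof.
move=> tor wh wd.
have wdeg : in_degree m (map_mx (mcoeff 0%MM) w).
  move=> l; rewrite wh !mxE; case: leqP => [le|_]; last by rewrite mcoeff0 eqxx.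
  rewrite mcoeff_hcomp mdeg0; case: ifP => [|_]; last by rewrite eqxx.
  by rewrite eq_sym subn_eq0 => ge _; apply/eqP; rewrite eqn_leq le ge.
have [|w0 _ ww0] := tor _ wdeg; first by rewrite /tor_cycle /diff_k -map_mxM.
pose w' := map_mx (@mpolyC n k) w0.
have cw' : map_mx (mcoeff 0%MM) w' = w0.
  by apply/matrixP => a b; rewrite !mxE mpolyCK.
exists w'.
have /fin_all_exists [h hP] : forall l : 'I_(rk F i.+1), exists h : 'I_n -> {mpoly k[n]},
    (w - w' *m diff F i.+1) 0 l = \sum_x 'X_x * h x.
  move=> l; have [] := @const0_var_comb _ _ ((w - w' *m diff F i.+1) 0 l).
    have := congr1 (fun M : 'rV_ _ => M 0 l) ww0; rewrite /diff_k -{1}cw' -map_mxM.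
    by rewrite !mxE => e; rewrite mcoeffB e subrr.
  by move=> h _ ->; exists h; rewrite big_enum.
exists (fun x => \row_l h l x); rewrite addrC; apply/eqP; rewrite -subr_eq.
apply/eqP/rowP => l; rewrite hP summxE.
by apply: eq_bigr => x _; rewrite !mxE.
Qed.

Lemma lift_family (T : finType) (g : T -> {mpoly k[n]}) :
  exists p, forall i, I (g i - augf (p i)).
Proof.
have /fin_all_exists [p pP] : forall i, exists p, I (g i - augf p).
  by move=> i; apply: aug_surj.
by exists p.
Qed.

Lemma diff_diff i : diff F i.+1 *m diff F i = 0.
Proof.
apply/row_matrixP => a; rewrite row0 row_mul.
by apply/exactS; exists (delta_mx 0 a); rewrite -rowE.
Qed.

Lemma mcoeff0_Xmul i f : ('X_i * f)@_0%MM = 0.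
Proof. by rewrite /= (rmorphM (mcoeff 0%MM)) /= mcoeffX mnm1_eq0 mul0r. Qed.

Lemma mcoeff0_sumX (i : nat) (s : seq 'I_n) (G : 'I_n -> 'rV[{mpoly k[n]}]_i) :
  map_mx (mcoeff 0%MM) (\sum_(x <- s) 'X_x *: G x) = 0.
Proof.
rewrite map_mx_sum big1 // => x _; apply/matrixP => a b; rewrite !mxE.
exact: mcoeff0_Xmul.
Qed.

Lemma lift_relation r f (g : 'I_n -> {mpoly k[n]}) p : I f -> f = \sum_(i <- r) 'X_i * g i ->
  (forall i, I (g i - augf (p i))) ->
  exists z, \sum_(i <- r) 'X_i *: p i = z *m diff F 0.
Proof.
move=> If fg gp; apply/exact0; rewrite -/(augf _) augf_sum.
have -> : \sum_(i <- r) augf ('X_i *: p i) =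
   f - \sum_(i <- r) 'X_i * (g i - augf (p i)).
  by rewrite {1}fg -sumrB; apply: eq_bigr => i _; rewrite augfZ; ring.
apply: idealB => //; apply: ideal_sum => // i _.
by case: iI => _ _; apply.
Qed.

Lemma hrow_relation r m p z :
  \sum_(i <- r) 'X_i *: p i = z *m diff F 0 ->
  \sum_(i <- r) 'X_i *: hrow 0 m (p i) = hrow 1 m.+1 z *m diff F 0.
Proof.
move=> zP; rewrite -hrow_diff -zP hrow_sum; apply: eq_bigr => i _.
by rewrite hrowX.
Qed.

Lemma homog_koszul_lift r m f (g : 'I_n -> {mpoly k[n]}) p u : uniq r -> f \is m.+1.-homog ->
  f = \sum_(i <- r) 'X_i * g i -> (forall i, I (g i - augf (p i))) ->
  \sum_(i <- r) 'X_i *: hrow 0 m (p i) = \sum_(i <- r) 'X_i *: (u i *m diff F 0) ->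
  var_comb r I f.
Proof.
move=> ur fh fg gp pu.
have -> : f = \sum_(i <- r) 'X_i * hcomp m (g i).
  rewrite -[LHS](pihomog_dE fh) {1}fg linear_sum; apply: eq_bigr => i _.
  exact: hcompXS.
apply: (koszul_lift ur _ pu) => i.
by rewrite hrow_aug -[_ - _]raddfB; case: I_hom => _; apply.
Qed.

(** I has no minimal generator in a degree where Tor_1 vanishes. *)
Lemma tor1_generation m f : tor_vanishes F 1 m.+1 -> I f -> f \is m.+1.-homog ->
  var_comb (enum 'I_n) I f.
Proof.
move=> tor If fh.
have [g _ fg] : var_comb (enum 'I_n) (fun=> True) f.
  apply: const0_var_comb; apply: (dhomog_nemf_coeff fh).
  by rewrite /= mdeg0.
have [p pP] := lift_family g.
have [z /(hrow_relation m) zP] := lift_relation If fg pP.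
have [||w [u zE]] := @tor_lift 0 m.+1 (hrow 1 m.+1 z) tor; first by rewrite hrow_id.
  by rewrite -zP mcoeff0_sumX.
apply: (@homog_koszul_lift _ m f g p u) => //; first exact: enum_uniq.
rewrite zP zE mulmxDl -mulmxA diff_diff mulmx0 add0r mulmx_suml big_enum /=.
by apply: eq_bigr => i _; rewrite scalemxAl.
Qed.

(** With r the variables other than x0, Tor_1(R/I, R/(r)) is the quotient of
    the elements of I in (r) by (r) I.  By the long exact sequence of
    multiplication by x0 on R/(r) = k[x0], the kernel of x0 on it is a quotient
    of Tor_2(R/I, k), one degree higher. *)
Lemma tor2_regularity m r x0 f : tor_vanishes F 2 m.+2 ->
  uniq r -> x0 \notin r -> (forall i, i = x0 \/ i \in r) ->
  I f -> f \is m.+1.-homog -> var_comb r I ('X_x0 * f) -> var_comb r I f.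
Proof.
move=> tor ur x0r x0T If fh [h Ih xf].
have [g _ fg] : var_comb r (fun=> True) f.
  by apply: (var_comb_regular ur x0r); exists h.
have [p pP] := lift_family g.
have [z zP] := lift_relation If fg pP.
have zP' := hrow_relation m zP.
(* The relation x0 f = sum x_i h_i makes x0 z homologous to a combination of
   the variables of r: x0 g_i - h_i is a syzygy of these variables. *)
have /koszul_exact [//|c cP] : \sum_(i <- r) 'X_i * ('X_x0 * g i - h i) = 0.
  have -> : \sum_(i <- r) 'X_i * ('X_x0 * g i - h i) =
    'X_x0 * \sum_(i <- r) 'X_i * g i - \sum_(i <- r) 'X_i * h i.
    by rewrite mulr_sumr -sumrB; apply: eq_bigr => i _; ring.
  by rewrite -fg -xf subrr.
have [q qP] := lift_family (fun ij : 'I_n * 'I_n => c ij.1 ij.2).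
pose e i := \sum_(j <- r) 'X_j *: (q (i, j) - q (j, i)).
have /fin_all_exists [y yP] : forall i, exists y, i \in r ->
    'X_x0 *: p i - e i = y *m diff F 0.
  move=> i; have [ir|] := boolP (i \in r); last by exists 0.
  suff /exact0 [y yP] : I (augf ('X_x0 *: p i - e i)) by exists y.
  rewrite augfB augfZ augf_sum.
  have -> : 'X_x0 * augf (p i) - \sum_(j <- r) augf ('X_j *: (q (i, j) - q (j, i)))
    = h i - 'X_x0 * (g i - augf (p i)) + \sum_(j <- r) 'X_j *
        ((c i j - augf (q (i, j))) - (c j i - augf (q (j, i)))).
    have -> : h i = 'X_x0 * g i - \sum_(j <- r) 'X_j * (c i j - c j i).
      by rewrite -cP //; ring.
    have -> : \sum_(j <- r) augf ('X_j *: (q (i, j) - q (j, i))) =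
       \sum_(j <- r) 'X_j * (c i j - c j i) - \sum_(j <- r) 'X_j *
        ((c i j - augf (q (i, j))) - (c j i - augf (q (j, i)))).
      by rewrite -sumrB; apply: eq_bigr => j _; rewrite augfZ augfB; ring.
    by ring.
  have [_ ID IM] := iI; apply: ID; first by apply: idealB => //; apply: IM.
  apply: ideal_sum => // j _; apply: IM.
  by apply: idealB => //; [exact: (qP (i, j)) | exact: (qP (j, i))].
have : ('X_x0 *: z - \sum_(i <- r) 'X_i *: y i) *m diff F 0 = 0.
  rewrite mulmxBl -scalemxAl -zP mulmx_suml.
  have -> : \sum_(i <- r) ('X_i *: y i) *m diff F 0 =
     'X_x0 *: (\sum_(i <- r) 'X_i *: p i) - \sum_(i <- r) 'X_i *: e i.
    rewrite scaler_sumr -sumrB !big_seq; apply: eq_bigr => i ir.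
    by rewrite -scalemxAl -yP // scalerBr !scalerA mulrC.
  rewrite opprB addrC subrK.
  apply/rowP => a; rewrite summxE mxE.
  rewrite -[RHS](koszul_cancel r (fun i j => q (i, j) 0 a)).
  apply: eq_bigr => i _; rewrite mxE summxE; congr (_ * _).
  by apply: eq_bigr => j _; rewrite !mxE.
case/exactS => w wP.
(* The chase took place in all degrees at once; from here on only the component
   where Tor_2 vanishes is kept. *)
have {wP} wP : hrow 2 m.+2 w *m diff F 1 =
   'X_x0 *: hrow 1 m.+1 z - \sum_(i <- r) 'X_i *: hrow 1 m.+1 (y i).
  rewrite -hrow_diff -wP hrowB hrowX hrow_sum; congr (_ - _).
  by apply: eq_bigr => i _; rewrite hrowX.
have perm_r : perm_eq (x0 :: r) (enum 'I_n).
  apply: uniq_perm; rewrite ?enum_uniq //= ?x0r // => i.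
  by rewrite mem_enum inE; case: (x0T i) => ->; rewrite ?eqxx ?orbT.
have [||w' [u wE]] := @tor_lift 1 m.+2 (hrow 2 m.+2 w) tor; first by rewrite hrow_id.
  rewrite wP raddfB /= mcoeff0_sumX subr0; apply/matrixP => a b; rewrite !mxE.
  exact: mcoeff0_Xmul.
(* x0 divides the left-hand side and is regular modulo r. *)
have zE : 'X_x0 *: (hrow 1 m.+1 z - u x0 *m diff F 1) =
   \sum_(i <- r) 'X_i *: (u i *m diff F 1 + hrow 1 m.+1 (y i)).
  under eq_bigr do rewrite scalerDr.
  rewrite big_split /= scalerBr; apply/eqP; rewrite subr_eq addrAC -subr_eq -wP wE.
  rewrite mulmxDl -mulmxA diff_diff mulmx0 add0r mulmx_suml -big_enum /=.
  rewrite -(perm_big _ perm_r) big_cons -!scalemxAl.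
  apply/eqP; rewrite [RHS]addrC; congr (_ + _).
  by apply: eq_bigr => i _; rewrite scalemxAl.
have /fin_all_exists [b bP] : forall a, exists b : 'I_n -> {mpoly k[n]},
    (hrow 1 m.+1 z - u x0 *m diff F 1) 0 a = \sum_(i <- r) 'X_i * b i.
  move=> a; have [|b _ ->] := @var_comb_regular _ _ r x0
       ((hrow 1 m.+1 z - u x0 *m diff F 1) 0 a) ur x0r; last by exists b.
  have := congr1 (fun M : 'rV_ _ => M 0 a) zE; rewrite mxE summxE => ->.
  exists (fun i => (u i *m diff F 1 + hrow 1 m.+1 (y i)) 0 a) => //.
  by apply: eq_bigr => i _; rewrite mxE.
apply: (@homog_koszul_lift r m f g p (fun i => \row_a b a i)) => //.
rewrite zP'.
have -> : hrow 1 m.+1 z = u x0 *m diff F 1 + \sum_(i <- r) 'X_i *: (\row_a b a i).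
  apply/eqP; rewrite addrC -subr_eq; apply/eqP/rowP => a.
  rewrite bP summxE; apply: eq_bigr => i _; by rewrite !mxE.
rewrite mulmxDl -mulmxA diff_diff mulmx0 add0r mulmx_suml.
by apply: eq_bigr => i _; rewrite scalemxAl.
Qed.

End Resolution.

(** * Polynomials in x_0 over k[x_1..x_n] and partial elimination ideals *)

Section Univariate.
Variables (k : fieldType) (n : nat).
Implicit Types (f g : {mpoly k[n.+1]}) (a h : {mpoly k[n]}).

Definition uni_var (i : 'I_n.+1) : {poly {mpoly k[n]}} :=
  if unlift ord0 i is Some j then ('X_j)%:P else 'X.

Fact uni_key : unit. Proof. exact: tt. Qed.

(** The isomorphism of k[x_0..x_n] with k[x_1..x_n][x_0].  It is locked so that
    comparing two of its values never unfolds the underlying sums. *)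
Definition uni : {mpoly k[n.+1]} -> {poly {mpoly k[n]}} :=
  locked_with uni_key (mmap (polyC \o @mpolyC n k) uni_var).

Lemma uniE f : uni f = mmap (polyC \o @mpolyC n k) uni_var f.
Proof. by rewrite /uni unlock. Qed.

Lemma uni_is_additive : additive uni.
Proof. by move=> f g; rewrite !uniE rmorphB. Qed.

Lemma uni_is_multiplicative : multiplicative uni.
Proof. by split=> [f g|]; rewrite !uniE ?rmorphM ?rmorph1. Qed.

HB.instance Definition _ := GRing.isAdditive.Build _ _ uni uni_is_additive.
HB.instance Definition _ := GRing.isMultiplicative.Build _ _ uni uni_is_multiplicative.

HB.instance Definition _ := GRing.RMorphism.copy (@embed_S1 k n)
  (comp_mpoly [tuple 'X_(lift ord0 j) | j < n]).

Definition mcons (i : nat) (u : 'X_{1..n}) : 'X_{1..n.+1} :=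
  [multinom if unlift ord0 j is Some l then u l else i | j < n.+1].

Definition mtail (t : 'X_{1..n.+1}) : 'X_{1..n} :=
  [multinom t (lift ord0 j) | j < n].

Lemma mcons_tail (t : 'X_{1..n.+1}) : t = mcons (t ord0) (mtail t).
Proof. by apply/mnmP => i; rewrite mnmE; case: unliftP => [j|] ->; rewrite ?mnmE. Qed.

Lemma mtail_cons i u : mtail (mcons i u) = u.
Proof. by apply/mnmP => j; rewrite !mnmE liftK. Qed.

Lemma mcons0 i u : mcons i u ord0 = i.
Proof. by rewrite mnmE unlift_none. Qed.

Lemma mdeg_mcons i u : mdeg (mcons i u) = (i + mdeg u)%N.
Proof.
rewrite !mdegE big_ord_recl mcons0; congr (_ + _)%N; apply: eq_bigr => j _.
by rewrite mnmE liftK.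
Qed.

Lemma uniX0 : uni 'X_ord0 = 'X.
Proof. by rewrite uniE mmapX mmap1U /uni_var unlift_none. Qed.

Lemma uniXlift j : uni 'X_(lift ord0 j) = ('X_j)%:P.
Proof. by rewrite uniE mmapX mmap1U /uni_var liftK. Qed.

Lemma uniC c : uni c%:MP = (c%:MP)%:P.
Proof. by rewrite uniE mmapC. Qed.

Lemma uniZ c f : uni (c *: f) = c%:MP *: uni f.
Proof. by rewrite -mul_mpolyC rmorphM /= uniC mul_polyC. Qed.

Lemma uniX (t : 'X_{1..n.+1}) : uni 'X_[t] = ('X_[mtail t])%:P * 'X^(t ord0).
Proof.
rewrite uniE mmapX /mmap1 big_ord_recl {1}/uni_var unlift_none mulrC.
congr (_ * _); rewrite mpolyXE_id rmorph_prod /=; apply: eq_bigr => j _.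
by rewrite /uni_var liftK rmorphXn mnmE.
Qed.

(** All facts about degrees and supports below are read off from this one. *)
Lemma mcoeff_uni f i u : ((uni f)`_i)@_u = f@_(mcons i u).
Proof.
rewrite {1}[f]mpolyE rmorph_sum /= coef_sum linear_sum [in RHS](mpolyE f) linear_sum.
apply: eq_bigr => t _ /=; rewrite uniZ coefZ uniX mul_mpolyC !mcoeffZ coefCM coefXn.
rewrite mcoeffX mulr_natr mcoeffMn mcoeffX; congr (_ * _).
rewrite {3}[t]mcons_tail.
have [<-|ne] := eqVneq i (t ord0); last first.
  rewrite mulr0n; suff /negbTE -> : mcons (t ord0) (mtail t) != mcons i u by [].
  by apply: contraNneq ne => e; rewrite -(mcons0 i u) -e mcons0.
rewrite mulr1n; congr (nat_of_bool _)%:R; apply/eqP/eqP => [->//|].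
by move/(congr1 mtail); rewrite !mtail_cons.
Qed.

Lemma uni_inj : injective uni.
Proof.
move=> f g e; apply/mpolyP => t.
by rewrite [t]mcons_tail -!mcoeff_uni e.
Qed.

Lemma uni_embed a : uni (embed_S1 a) = a%:P.
Proof.
rewrite /embed_S1 {2}[a]mpolyE comp_mpolyEX !rmorph_sum /=; apply: eq_bigr => u _.
rewrite uniZ -mul_mpolyC polyCM mul_polyC; congr (_ *: _).
rewrite comp_mpolyX mpolyXE_id !rmorph_prod; apply: eq_bigr => j _.
by rewrite tnth_mktuple !rmorphXn /= uniXlift.
Qed.

Definition of_uni (p : {poly {mpoly k[n]}}) : {mpoly k[n.+1]} :=
  \sum_(i < size p) embed_S1 p`_i * 'X_ord0 ^+ i.

Lemma of_uniK p : uni (of_uni p) = p.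
Proof.
rewrite /of_uni rmorph_sum /= -[RHS]coefK poly_def; apply: eq_bigr => i _.
by rewrite rmorphM rmorphXn /= uni_embed uniX0 mul_polyC.
Qed.

Lemma uni_hcomp m f i : (uni (hcomp m f))`_i =
  if (i <= m)%N then hcomp (m - i) (uni f)`_i else 0.
Proof.
apply/mpolyP => u; rewrite mcoeff_uni mcoeff_hcomp mdeg_mcons.
case: leqP => le; last by rewrite mcoeff0 gtn_eqF // ltn_addr.
by rewrite mcoeff_hcomp mcoeff_uni -{1}(subnKC le) eqn_add2l.
Qed.

Lemma size_uni_hcomp m f e : (size (uni f) <= e)%N ->
  (size (uni (hcomp m f)) <= e)%N.
Proof.
move=> /leq_sizeP sf; apply/leq_sizeP => i /sf fi.
by rewrite uni_hcomp fi /hcomp pihomog0 if_same.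
Qed.

Lemma uni_homog m f i : f \is m.-homog ->
  (uni f)`_i \is (m - i).-homog.
Proof.
move=> fh; rewrite -(pihomog_dE fh) -/(hcomp m f) uni_hcomp.
by case: leqP => _; [apply: pihomogP | apply: dhomog0].
Qed.

Lemma uni_homog0 m f i : f \is m.-homog -> (m < i)%N -> (uni f)`_i = 0.
Proof.
by move=> fh lt; rewrite -(pihomog_dE fh) -/(hcomp m f) uni_hcomp leqNgt lt.
Qed.

Lemma hcomp_embed m a : hcomp m (embed_S1 a) = embed_S1 (hcomp m a).
Proof.
apply: uni_inj; rewrite [RHS]uni_embed; apply/polyP => i.
rewrite uni_hcomp [uni _]uni_embed.
rewrite [RHS]coefC [in LHS]coefC.
have [->|_] := eqVneq i 0%N.
  by rewrite leq0n subn0.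
by rewrite /hcomp pihomog0 if_same.
Qed.

Lemma embed_homog m a : a \is m.-homog -> embed_S1 a \is m.-homog.
Proof. by move=> ah; rewrite -(pihomog_dE ah) -hcomp_embed; apply: pihomogP. Qed.

Lemma size_uni_embedM a f e : (size (uni f) <= e)%N ->
  (size (uni (embed_S1 a * f)) <= e)%N.
Proof.
by move=> sf; rewrite rmorphM /= uni_embed mul_polyC (leq_trans (size_scale_leq _ _)).
Qed.

Lemma coef_uni_embedM a f i : (uni (embed_S1 a * f))`_i = a * (uni f)`_i.
Proof. by rewrite rmorphM /= uni_embed coefCM. Qed.

Lemma size_uniB f g e : (size (uni f) <= e)%N -> (size (uni g) <= e)%N ->
  (size (uni (f - g)) <= e)%N.
Proof.
move=> sf sg; rewrite rmorphB (leq_trans (size_polyD _ _)) //.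
by rewrite geq_max sf size_polyN.
Qed.

Lemma size_uniD f g e : (size (uni f) <= e)%N -> (size (uni g) <= e)%N ->
  (size (uni (f + g)) <= e)%N.
Proof.
move=> sf sg; rewrite rmorphD /=; apply: leq_trans (size_polyD _ _) _.
by rewrite geq_max sf.
Qed.

Lemma msupp_uni f (t : 'X_{1..n.+1}) : t \in msupp f -> (t ord0 < size (uni f))%N.
Proof.
rewrite mcoeff_msupp [t]mcons_tail -mcoeff_uni mcons0 ltnNge.
by apply: contraNN => /leq_sizeP/(_ _ (leqnn _)) ->; rewrite mcoeff0.
Qed.

Lemma size_uni_msupp f e : (forall t, t \in msupp f -> (t ord0 < e)%N) ->
  (size (uni f) <= e)%N.
Proof.
move=> fe; apply/leq_sizeP => i le; apply/mpolyP => u.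
rewrite mcoeff_uni mcoeff0; apply/eqP; rewrite mcoeff_eq0.
by apply: contraTN le => /fe; rewrite mcons0 -ltnNge.
Qed.

End Univariate.

Section PartialElim.
Variables (k : fieldType) (n : nat) (I : {mpoly k[n.+1]} -> Prop).
Hypothesis I_hom : homogeneous_ideal I.

(** At i + 1, the module over k[x_1..x_n] whose coefficients of x_0^i make up
    the i-th partial elimination ideal. *)
Definition elim_module (i : nat) (f : {mpoly k[n.+1]}) : Prop :=
  I f /\ (size (uni f) <= i)%N.

(** On a homogeneous polynomial the leading term for the degree lexicographic
    order has the largest exponent of x_0, so the bound on leading terms is a
    bound on the degree in x_0. *)
Lemma partial_elimP i h : partial_elim I i h <->
  exists2 f, elim_module i.+1 f & (uni f)`_i = h.
Proof.
split=> [[f [g [fI fE gi]]] | [f [If sf] fh]].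
  have sg : (size (uni g) <= i)%N by apply: size_uni_msupp.
  have uf : uni f = h *: 'X^i + uni g.
    by rewrite fE rmorphD rmorphM rmorphXn /= uniX0 uni_embed mulrC mul_polyC.
  exists f; first split.
  - by apply: homogeneous_idealE => // m; case: (fI m).
  - rewrite uf (leq_trans (size_polyD _ _)) // geq_max (leq_trans sg) // andbT.
    by rewrite (leq_trans (size_scale_leq _ _)) // size_polyXn.
  - by rewrite uf coefD coefZ coefXn eqxx mulr1 (leq_sizeP _ _ sg) ?addr0.
exists f, (f - 'X_ord0 ^+ i * embed_S1 h); split.
- move=> m; split; first by case: I_hom => _; apply.
  have [->|nz] := eqVneq (hcomp m f) 0; first by rewrite /lead_x0 mlead0 mnm0E.
  rewrite -ltnS (leq_trans (msupp_uni (mlead_supp nz))) //.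
  exact: size_uni_hcomp.
- by rewrite addrC subrK.
- move=> t /msupp_uni lt; apply: (leq_trans lt).
  apply/leq_sizeP => j le.
  rewrite rmorphB rmorphM rmorphXn /= uniX0 uni_embed mulrC mul_polyC.
  rewrite coefB coefZ coefXn.
  have [->|ne] := eqVneq j i; first by rewrite fh mulr1 subrr.
  by rewrite mulr0 subr0 (leq_sizeP _ _ sf) // ltn_neqAle eq_sym ne.
Qed.

Lemma partial_elim_ideal i : ideal (partial_elim I i).
Proof.
case: I_hom => [[I0 ID IM] _]; split.
- apply/partial_elimP; exists 0; last by rewrite rmorph0 coef0.
  by split=> //; rewrite rmorph0 size_poly0.
- move=> _ _ /partial_elimP[f [If sf] <-] /partial_elimP[g [Ig sg] <-].
  apply/partial_elimP; exists (f + g); last by rewrite rmorphD coefD.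
  by split; [apply: ID | apply: size_uniD].
- move=> a _ /partial_elimP[f [If sf] <-].
  apply/partial_elimP; exists (embed_S1 a * f); last exact: coef_uni_embedM.
  by split; [apply: IM | apply: size_uni_embedM].
Qed.

End PartialElim.

(** * Generators of the elimination module below a monic element *)

Section TailVars.
Variable n : nat.

Definition tail_vars : seq 'I_n.+1 := [seq lift ord0 j | j <- enum 'I_n].

Lemma uniq_tail_vars : uniq tail_vars.
Proof. by rewrite map_inj_uniq ?enum_uniq //; apply: lift_inj. Qed.

Lemma ord0_tail_vars : ord0 \notin tail_vars.
Proof. by apply/mapP => -[j _ /eqP]; rewrite (negbTE (neq_lift _ _)). Qed.

Lemma mem_tail_vars i : i = ord0 \/ i \in tail_vars.
Proof.
case: (unliftP ord0 i) => [j|] ->; [right | by left].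
by apply: map_f; rewrite mem_enum.
Qed.

Lemma big_tail_vars (T : nmodType) (G : 'I_n.+1 -> T) :
  \sum_(i <- tail_vars) G i = \sum_j G (lift ord0 j).
Proof. by rewrite big_map big_enum. Qed.

End TailVars.

Section ElimGeneration.
Variables (k : fieldType) (n d : nat) (I : {mpoly k[n.+1]} -> Prop).
Hypothesis I_hom : homogeneous_ideal I.
Let r := tail_vars n.
Hypothesis reg_le : forall m f, (d <= m)%N -> I f -> f \is m.+1.-homog ->
  var_comb r I ('X_ord0 * f) -> var_comb r I f.
Variable F : {mpoly k[n.+1]}.
Hypotheses (I_F : I F) (F_homog : F \is d.-homog) (F_monic : (uni F)`_d = 1).
Implicit Types (f g : {mpoly k[n.+1]}) (a : {mpoly k[n]}).

Let iI : ideal I. Proof. by case: I_hom. Qed.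

Lemma var_comb_tail f : var_comb r I f <->
  exists2 h : 'I_n -> _, (forall j, I (h j)) & f = \sum_j 'X_(lift ord0 j) * h j.
Proof.
split=> [[h Ih ->]|[h Ih ->]].
  by exists (fun j => h (lift ord0 j)); rewrite ?big_tail_vars.
exists (fun i => if unlift ord0 i is Some j then h j else 0).
  by move=> i; case: unliftP => // _; case: iI.
by rewrite big_tail_vars; apply: eq_bigr => j _; rewrite liftK.
Qed.

Lemma hcomp_var_comb s m f : var_comb s I f -> var_comb s I (hcomp m f).
Proof.
case=> h Ih ->; case: m => [|m].
  rewrite /hcomp linear_sum /= big1 => [|i _]; last exact: hcompX0.
  by case: (var_comb_ideal s iI).
exists (fun i => hcomp m (h i)) => [i|]; first by case: I_hom => _; apply.
by rewrite /hcomp linear_sum; apply: eq_bigr => i _; apply: hcompXS.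
Qed.

Lemma size_uniF : size (uni F) = d.+1.
Proof.
apply/eqP; rewrite eqn_leq; apply/andP; split.
  by apply/leq_sizeP => i lt; apply: (uni_homog0 F_homog).
rewrite ltnNge; apply/negP => /leq_sizeP/(_ _ (leqnn d))/eqP.
by rewrite F_monic oner_eq0.
Qed.

Lemma uniF_monic : uni F \is monic.
Proof. by rewrite monicE lead_coefE size_uniF F_monic. Qed.

Lemma divF f : exists q f', [/\ f = q * F + f', (size (uni f') <= d)%N & (I f -> I f')].
Proof.
have e := Pdiv.RingMonic.rdivp_eq uniF_monic (uni f).
exists (of_uni (Pdiv.CommonRing.rdivp (uni f) (uni F))).
exists (of_uni (Pdiv.CommonRing.rmodp (uni f) (uni F))).
have fE : f = of_uni (Pdiv.CommonRing.rdivp (uni f) (uni F)) * F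
              + of_uni (Pdiv.CommonRing.rmodp (uni f) (uni F)).
  by apply: uni_inj; rewrite rmorphD rmorphM /= !of_uniK.
split=> //.
  rewrite of_uniK -ltnS -size_uniF Pdiv.CommonRing.ltn_rmodp.
  by rewrite -size_poly_eq0 size_uniF.
move=> If; have -> : of_uni (Pdiv.CommonRing.rmodp (uni f) (uni F)) =
   f - of_uni (Pdiv.CommonRing.rdivp (uni f) (uni F)) * F by rewrite {2}fE; ring.
by apply: idealB => //; case: iI => _ _; apply.
Qed.

Lemma multiple_of_F_eq0 b : (size (uni (b * F)) <= d)%N -> b * F = 0.
Proof.
rewrite rmorphM /= => sb; apply: uni_inj; rewrite rmorph0 rmorphM /=.
have [->|nz] := eqVneq (uni b) 0; first by rewrite mul0r.
move: sb; rewrite size_proper_mul.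
  by rewrite size_uniF addnS /= leqNgt => /negP[]; rewrite -[ltnLHS]add0n ltn_add2r size_poly_gt0.
by rewrite (monicP uniF_monic) mulr1 lead_coef_eq0.
Qed.

(** The only monomial of degree d free of x_1, .., x_n is x_0^d. *)
Lemma F_mod_vars : var_comb r (fun=> True) (F - 'X_ord0 ^+ d).
Proof.
apply: mPo_var_comb; first exact: uniq_tail_vars.
rewrite comp_mpolyEX big1_seq // => t /= tF.
have [t0|] := eqVneq (mtail t) 0%MM.
  move: tF; rewrite mcoeff_msupp => /negP[]; apply/eqP.
  rewrite [t]mcons_tail t0 -mcoeff_uni rmorphB rmorphXn /= uniX0 coefB coefXn.
  have [->|ne] := eqVneq; first by rewrite F_monic subrr mcoeff0.
  rewrite subr0 mcoeff_uni; apply: (dhomog_nemf_coeff F_homog).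
  by rewrite /= mdeg_mcons mdeg0 addn0.
rewrite -mdeg_eq0 mdegE sum_nat_eq0 negb_forall => /existsP[j].
rewrite mnmE /= => tj.
rewrite comp_mpolyX (bigD1 (lift ord0 j)) //= tnth_mktuple map_f ?mem_enum // expr0n.
by rewrite (negbTE tj) mul0r scaler0.
Qed.

(** The claim holds after multiplication by x_0^d, by [F_mod_vars].  To cancel
    one factor x_0, write x_0 f = b F modulo (x_1, .., x_n) I with b homogeneous
    of positive degree and b = x_0 b_0 modulo x_1, .., x_n; then
    x_0 (f - b_0 F) lies in (x_1, .., x_n) I, and [reg_le] applies. *)
Lemma mod_monic_and_vars m f : (d <= m)%N -> I f -> f \is m.+1.-homog ->
  exists b, var_comb r I (f - b * F).
Proof.
have [C0 CD CM] := var_comb_ideal r iI; have [I0 ID IM] := iI.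
suff desc e : forall m f, (d <= m)%N -> I f -> f \is m.+1.-homog ->
    (exists b, var_comb r I ('X_ord0 ^+ e * f - b * F)) ->
    exists b, var_comb r I (f - b * F).
  move=> dm If fh; apply: (desc d m f) => //; exists f.
  have [h _ hE] := F_mod_vars.
  have -> : 'X_ord0 ^+ d * f - f * F = - f * (F - 'X_ord0 ^+ d) by ring.
  rewrite hE; exists (fun i => - (f * h i)) => [i|].
    by apply: idealN => //; rewrite mulrC; apply: IM.
  by rewrite mulr_sumr; apply: eq_bigr => i _; ring.
elim: e => [|e IHe] {m f} m f dm If fh; first by rewrite expr0 mul1r.
rewrite exprSr -mulrA => ex_b; have [||b] := IHe m.+1 ('X_ord0 * f) (leqW dm) _ _ ex_b.
- exact: IM.
- by rewrite -[m.+2]add1n; apply: dhomogM => //; rewrite dhomogX /= mdeg1.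
move/(hcomp_var_comb m.+2).
have -> : hcomp m.+2 ('X_ord0 * f - b * F) =
    'X_ord0 * f - hcomp (m.+2 - d) b * F.
  rewrite /hcomp raddfB; congr (_ - _).
    by rewrite [LHS]hcompXS /hcomp (pihomog_dE fh).
  rewrite mulrC [LHS](hcompM _ _ F_homog) (leq_trans dm) 1?mulrC //.
  by rewrite -addn2 leq_addr.
set b' := hcomp _ b => Jb.
have dm2 : (m.+2 - d = (m.+1 - d).+1)%N by rewrite subSn ?leqW.
have [c _ b'E] : var_comb (enum 'I_n.+1) (fun=> True) b'.
  apply: const0_var_comb; rewrite mcoeff_hcomp mdeg0 dm2.
  by [].
pose c' i := hcomp (m.+1 - d) (c i).
have {}b'E : b' = 'X_ord0 * c' ord0 + \sum_j 'X_(lift ord0 j) * c' (lift ord0 j).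
  have -> : b' = hcomp (m.+1 - d).+1 b'.
    by rewrite -dm2 /b' /hcomp pihomog_id.
  rewrite b'E /hcomp linear_sum /= big_enum big_ord_recl; congr (_ + _).
    exact: hcompXS.
  by apply: eq_bigr => j _; apply: hcompXS.
exists (c' ord0); apply: (reg_le dm).
- by apply: idealB => //; apply: IM.
- rewrite rpredB // -[m.+1](subnK (leqW dm)); apply: dhomogM => //.
  exact: pihomogP.
have -> : 'X_ord0 * (f - c' ord0 * F) = ('X_ord0 * f - b' * F) +
    \sum_j 'X_(lift ord0 j) * (c' (lift ord0 j) * F).
  rewrite b'E; under [X in _ = _ + X]eq_bigr do rewrite mulrA.
  rewrite -mulr_suml; by ring.
apply: CD => //; apply/var_comb_tail.
by exists (fun j => c' (lift ord0 j) * F) => // j; apply: IM.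
Qed.

(** In f = b F + sum x_j g_j, reducing each g_j modulo F leaves a multiple of F
    of x_0-degree less than d, which is zero. *)
Lemma elim_module_step m f : (d <= m)%N -> elim_module I d f -> f \is m.+1.-homog ->
  exists2 h : 'I_n -> _, forall j, elim_module I d (h j) /\ h j \is m.-homog
    & f = \sum_j 'X_(lift ord0 j) * h j.
Proof.
move=> dm [If sf] fh; have [b /var_comb_tail[g Ig fb]] := mod_monic_and_vars dm If fh.
have /fin_all_exists [g' g'P] : forall j, exists g', [/\ I g', (size (uni g') <= d)%N &
    exists q, g j = q * F + g'].
  by move=> j; have [q [g' [e sg' Ig']]] := divF (g j); exists g'; split; [exact: Ig' | | exists q].
have /fin_all_exists [q qP] : forall j, exists q, g j = q * F + g' j.
  by move=> j; case: (g'P j).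
have fE : f - \sum_j 'X_(lift ord0 j) * g' j =
    (b + \sum_j 'X_(lift ord0 j) * q j) * F.
  have -> : f = b * F + (f - b * F) by ring.
  rewrite fb mulrDl mulr_suml -addrA -sumrB; congr (_ + _).
  by apply: eq_bigr => j _; rewrite qP; ring.
have sX j : (size (uni ('X_(lift ord0 j) * g' j)) <= d)%N.
  rewrite rmorphM /= uniXlift mul_polyC (leq_trans (size_scale_leq _ _)) //.
  by case: (g'P j).
have /multiple_of_F_eq0 : (size (uni ((b + \sum_j 'X_(lift ord0 j) * q j) * F)) <= d)%N.
  rewrite -fE; apply: size_uniB => //; rewrite rmorph_sum.
  by apply: (leq_trans (size_sum _ _ _)); apply/bigmax_leqP => j _; exact: sX.
rewrite -fE => /eqP; rewrite subr_eq0 => /eqP {}fE.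
exists (fun j => hcomp m (g' j)).
  move=> j; case: (g'P j) => Ig' sg' _; split; last exact: pihomogP.
  by split; [case: I_hom => _; apply | apply: size_uni_hcomp].
rewrite -[LHS](pihomog_dE fh) {1}fE linear_sum; apply: eq_bigr => j _.
exact: hcompXS.
Qed.

End ElimGeneration.

Section Span.
Variables (k : fieldType) (n : nat).
Implicit Types (f g : {mpoly k[n.+1]}) (G : {mpoly k[n.+1]} -> Prop).

Definition S1_span G f : Prop :=
  forall M : {mpoly k[n.+1]} -> Prop, M 0 -> (forall u v, M u -> M v -> M (u + v)) ->
    (forall a u, G u -> M (embed_S1 a * u)) -> M f.

Lemma S1_span0 G : S1_span G 0.
Proof. by []. Qed.

Lemma S1_spanD G f g : S1_span G f -> S1_span G g -> S1_span G (f + g).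
Proof. by move=> Gf Gg M M0 MD MG; apply: (MD); [exact: (Gf M) | exact: (Gg M)]. Qed.

Lemma S1_span_gen G a f : G f -> S1_span G (embed_S1 a * f).
Proof. by move=> Gf M M0 MD MG; apply: MG. Qed.

Lemma S1_spanM G a f : S1_span G f -> S1_span G (embed_S1 a * f).
Proof.
move=> /(_ (fun g => S1_span G (embed_S1 a * g))); apply.
- by rewrite mulr0.
- by move=> u v; rewrite mulrDr; apply: S1_spanD.
- by move=> b u Gu; rewrite mulrA -rmorphM; apply: S1_span_gen.
Qed.

Lemma S1_span_sum (T : Type) (s : seq T) (P : pred T) G (H : T -> {mpoly k[n.+1]}) :
  (forall i, P i -> S1_span G (H i)) -> S1_span G (\sum_(i <- s | P i) H i).
Proof. by move=> GH; apply: (big_ind (S1_span G)) => //; exact: S1_spanD. Qed.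

Lemma S1_span_id G f : G f -> S1_span G f.
Proof. by move=> /(S1_span_gen 1); rewrite rmorph1 mul1r. Qed.

End Span.

Definition elim_le (k : fieldType) (n : nat) (I : {mpoly k[n.+1]} -> Prop) (i e : nat)
    (f : {mpoly k[n.+1]}) : Prop :=
  elim_module I i f /\ exists2 m, (m <= e)%N & f \is m.-homog.

(** Taking the coefficient of x_0^i lowers degrees by i. *)
Lemma partial_elim_generated (k : fieldType) (n : nat) (I : {mpoly k[n.+1]} -> Prop) i e :
  homogeneous_ideal I ->
  (forall f, elim_module I i.+1 f -> S1_span (elim_le I i.+1 (i + e)) f) ->
  generated_in_degrees_le (partial_elim I i) e.
Proof.
move=> I_hom span.
exists (fun a => partial_elim I i a /\ exists2 m, (m <= e)%N & a \is m.-homog).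
split=> [a [] // | a]; split; last first.
  by move/(_ _ (partial_elim_ideal I_hom i)); apply => g [].
move/(partial_elimP I_hom) => [f /span sf <-] A iA AG.
have [A0 AD AM] := iA.
apply: (sf (fun f => A (uni f)`_i)).
- by rewrite rmorph0 coef0.
- by move=> u v Au Av; rewrite rmorphD coefD; apply: AD.
move=> b u [Iu [m le uh]]; rewrite coef_uni_embedM; apply: AM; apply: AG.
split; first by apply/(partial_elimP I_hom); exists u.
exists (m - i)%N; last exact: uni_homog.
by rewrite leq_subLR.
Qed.

Lemma elim_module_span (k : fieldType) (n d : nat) (I : {mpoly k[n.+1]} -> Prop) :
  homogeneous_ideal I ->
  (forall m f, (d <= m)%N -> elim_module I d f -> f \is m.+1.-homog ->
    exists2 h : 'I_n -> _, forall j, elim_module I d (h j) /\ h j \is m.-homog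
      & f = \sum_j 'X_(lift ord0 j) * h j) ->
  forall f, elim_module I d f -> S1_span (elim_le I d d) f.
Proof.
move=> I_hom step.
suff hom m : forall f, elim_module I d f -> f \is m.-homog -> S1_span (elim_le I d d) f.
  move=> f [If sf]; rewrite (hcomp_sum f); apply: S1_span_sum => i _.
  apply: (hom i); last exact: pihomogP.
  by split; [case: I_hom => _; apply | apply: size_uni_hcomp].
elim: m => [|m IHm] f Kf fh.
  by apply: S1_span_id; split=> //; exists 0.
have [dm|md] := leqP d m; last first.
  by apply: S1_span_id; split=> //; exists m.+1.
have [h hP ->] := step m f dm Kf fh.
apply: S1_span_sum => j _; have [Kh hh] := hP j.
have -> : 'X_(lift ord0 j) = embed_S1 'X_j :> {mpoly k[n.+1]}.
  by apply: uni_inj; rewrite uni_embed uniXlift.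
exact: S1_spanM (IHm _ Kh hh).
Qed.

(** * The second partial elimination ideal *)

Section Linear.
Variables (k : fieldType) (n : nat).
Implicit Types (f g : {mpoly k[n]}).

Lemma linear_formE g : g \is 1.-homog -> g = \sum_j g@_U_(j) *: 'X_j.
Proof.
move=> gh; apply/mpolyP => t; rewrite linear_sum /=.
have [/eqP/mdeg1P[i /eqP ->]|ne] := eqVneq (mdeg t) 1%N.
  rewrite (bigD1 i) //= mcoeffZ mcoeffXU eqxx mulr1 big1 ?addr0 // => j ne.
  by rewrite mcoeffZ mcoeffXU (negbTE ne) mulr0.
rewrite (dhomog_nemf_coeff gh) // big1 // => j _.
rewrite mcoeffZ mcoeffX; have [e|_] := eqVneq U_(j)%MM t; last by rewrite mulr0.
by rewrite -e mdeg1 in ne.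
Qed.

Lemma comp_mpolyA (s t : n.-tuple {mpoly k[n]}) f :
  (f \mPo s) \mPo t = f \mPo [tuple (tnth s i \mPo t) | i < n].
Proof.
rewrite [f \mPo s]comp_mpolyEX [RHS]comp_mpolyEX linear_sum /=; apply: eq_bigr => u _.
rewrite comp_mpolyZ !comp_mpolyX rmorph_prod /=; congr (_ *: _).
by apply: eq_bigr => i _; rewrite rmorphXn /= tnth_mktuple.
Qed.

Lemma linear_comp_homog (s : n.-tuple {mpoly k[n]}) g :
  (forall i, tnth s i \is 1.-homog) -> g \is 1.-homog -> g \mPo s \is 1.-homog.
Proof.
move=> sh /linear_formE ->; rewrite linear_sum; apply: rpred_sum => i _ /=.
by rewrite comp_mpolyZ comp_mpolyXU -tnth_nth; apply: rpredZ.
Qed.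

(** Solves the linear equation h = 0 for the variable of index i. *)
Definition elim_var (i : 'I_n) (h : {mpoly k[n]}) : n.-tuple {mpoly k[n]} :=
  [tuple if j == i then 'X_i - (h@_U_(i))^-1 *: h else 'X_j | j < n].

Lemma elim_varE i h g : g \is 1.-homog ->
  g \mPo elim_var i h = g - (g@_U_(i) / h@_U_(i)) *: h.
Proof.
move=> gh; rewrite {1 2}(linear_formE gh) linear_sum /=.
rewrite (bigD1 i) //= [in RHS](bigD1 i) //= addrAC.
congr (_ + _).
  rewrite comp_mpolyZ comp_mpolyXU -tnth_nth tnth_mktuple eqxx.
  by rewrite scalerBr scalerA.
apply: eq_bigr => j /negbTE ne.
by rewrite comp_mpolyZ comp_mpolyXU -tnth_nth tnth_mktuple ne.
Qed.

End Linear.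

Section SecondElim.
Variables (k : fieldType) (n t : nat) (I : {mpoly k[n.+1]} -> Prop).
Hypothesis I_hom : homogeneous_ideal I.
Hypothesis K_span :
  forall f, elim_module I t.+1 f -> S1_span (elim_le I t.+1 t.+1) f.
Implicit Types (f g phi psi : {mpoly k[n.+1]}) (a b : {mpoly k[n]}).
Implicit Type s : seq {mpoly k[n.+1]}.

Let iI : ideal I. Proof. by case: I_hom. Qed.

Local Notation lc f := ((uni f)`_t).
Local Notation G := (elim_le I t.+1 t.+1).
Local Notation G2 := (elim_le I t t.+2).
Local Notation span s := (S1_span (fun g => g \in s)).

Lemma elim_moduleD i f g : elim_module I i f -> elim_module I i g ->
  elim_module I i (f + g).
Proof. by move=> [If sf] [Ig sg]; split; [case: iI => _ + _; apply | apply: size_uniD]. Qed.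

Lemma elim_moduleM i a f : elim_module I i f -> elim_module I i (embed_S1 a * f).
Proof. by move=> [If sf]; split; [case: iI => _ _; apply | apply: size_uni_embedM]. Qed.

Lemma elim_moduleB i f g : elim_module I i f -> elim_module I i g ->
  elim_module I i (f - g).
Proof. by move=> [If sf] [Ig sg]; split; [apply: idealB | apply: size_uniB]. Qed.

Lemma elim_module_lower f : elim_module I t.+1 f -> lc f = 0 -> elim_module I t f.
Proof.
move=> [If sf] f0; split=> //; apply/leq_sizeP => i; rewrite leq_eqVlt.
by case/orP => [/eqP <- // | lt]; apply: (leq_sizeP _ _ sf).
Qed.

Lemma S1_span_mono (P Q : {mpoly k[n.+1]} -> Prop) f :
  (forall g, P g -> Q g) -> S1_span P f -> S1_span Q f.
Proof.
move=> PQ Pf; apply: (Pf (S1_span Q)) => [||a u /PQ]; first exact: S1_span0.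
  exact: S1_spanD.
exact: S1_span_gen.
Qed.

Lemma S1_span_finite (P : {mpoly k[n.+1]} -> Prop) f :
  S1_span P f -> exists2 s : seq {mpoly k[n.+1]}, (forall g, g \in s -> P g) & span s f.
Proof.
move/(_ (fun f => exists2 s : seq {mpoly k[n.+1]}, (forall g, g \in s -> P g) & span s f)); apply.
- by exists [::] => //; apply: S1_span0.
- move=> u v [s1 P1 su] [s2 P2 sv]; exists (s1 ++ s2).
    by move=> g; rewrite mem_cat => /orP[/P1|/P2].
  apply: S1_spanD; [apply: S1_span_mono su | apply: S1_span_mono sv] => g gs.
    by rewrite mem_cat gs.
  by rewrite mem_cat gs orbT.
- move=> a u Pu; exists [:: u] => [g|]; first by rewrite inE => /eqP ->.
  by apply: S1_span_gen; rewrite inE.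
Qed.

Lemma span_cons phi s f : span (phi :: s) f ->
  exists a f0, span s f0 /\ f = embed_S1 a * phi + f0.
Proof.
move/(_ (fun f => exists a f0, span s f0 /\ f = embed_S1 a * phi + f0)); apply.
- by exists 0, 0; split; [apply: S1_span0 | rewrite rmorph0; ring].
- move=> _ _ [a [u [su ->]]] [b [v [sv ->]]]; exists (a + b), (u + v).
  by split; [apply: S1_spanD | rewrite rmorphD; ring].
- move=> a u; rewrite inE => /orP[/eqP ->|us].
    by exists a, 0; split; [apply: S1_span0 | rewrite addr0].
  exists 0, (embed_S1 a * u); split; first exact: S1_span_gen.
  by rewrite rmorph0; ring.
Qed.

Lemma span_elim s f : (forall g, g \in s -> G g) -> span s f -> elim_module I t.+1 f.
Proof.
move=> sG /(_ (elim_module I t.+1)); apply.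
- by split; [case: iI | rewrite rmorph0 size_poly0].
- exact: elim_moduleD.
- by move=> a u /sG[Ku _]; apply: elim_moduleM.
Qed.

Lemma span_hcomp s f m : (forall g, g \in s -> G g) -> span s f -> span s (hcomp m f).
Proof.
move=> sG /(_ (fun f => span s (hcomp m f))); apply.
- by rewrite /hcomp pihomog0; apply: S1_span0.
- by move=> u v su sv; rewrite /hcomp pihomogD; apply: S1_spanD.
move=> a u us; have [_ [e _ uh]] := sG u us.
rewrite mulrC (hcompM _ _ uh); case: ifP => _; last exact: S1_span0.
by rewrite mulrC hcomp_embed; apply: S1_span_gen.
Qed.

(** The Koszul syzygy of two leading coefficients: the coefficients of x_0^t
    cancel, and since they have degree at most 1, the degree grows by at most
    1. *)
Lemma G_swap phi psi : G phi -> G psi ->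
  G2 (embed_S1 (lc psi) * phi - embed_S1 (lc phi) * psi).
Proof.
move=> [Kphi [e le_e phih]] [Kpsi [e' le_e' psih]]; split.
  apply: elim_module_lower.
    by apply: elim_moduleB; apply: elim_moduleM.
  by rewrite rmorphB coefB !coef_uni_embedM mulrC subrr.
have [lt|ge] := ltnP e t.
  rewrite [lc phi](uni_homog0 phih lt) rmorph0 mul0r subr0.
  have [lt'|ge'] := ltnP e' t.
    exists 0 => //; rewrite [lc psi](uni_homog0 psih lt') rmorph0 mul0r.
    exact: dhomog0.
  exists ((e' - t) + e)%N.
    by rewrite -[t.+2]add1n leq_add // leq_subLR addn1.
  by apply: dhomogM => //; apply: embed_homog; apply: uni_homog.
exists ((e - t) + e')%N.
  by rewrite -[t.+2]add1n leq_add // leq_subLR addn1.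
rewrite rpredB //; last first.
  by apply: dhomogM => //; apply: embed_homog; apply: uni_homog.
have [lt'|ge'] := ltnP e' t.
  by rewrite [lc psi](uni_homog0 psih lt') rmorph0 mul0r; apply: dhomog0.
have -> : (e - t + e' = e' - t + e)%N.
  by rewrite addnBAC // [RHS]addnBAC // addnC.
by apply: dhomogM => //; apply: embed_homog; apply: uni_homog.
Qed.

Lemma span_swap s phi psi : (forall g, g \in s -> G g) -> G phi -> span s psi ->
  S1_span G2 (embed_S1 (lc psi) * phi - embed_S1 (lc phi) * psi).
Proof.
move=> sG Gphi /(_ (fun psi => S1_span G2 (embed_S1 (lc psi) * phi - embed_S1 (lc phi) * psi))).
apply.
- by rewrite rmorph0 coef0 rmorph0 mul0r mulr0 subr0; apply: S1_span0.
- move=> u v su sv.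
  have -> : embed_S1 (lc (u + v)) * phi - embed_S1 (lc phi) * (u + v) =
    (embed_S1 (lc u) * phi - embed_S1 (lc phi) * u)
    + (embed_S1 (lc v) * phi - embed_S1 (lc phi) * v).
    by rewrite rmorphD coefD rmorphD; ring.
  exact: S1_spanD.
move=> a u /sG Gu.
have -> : embed_S1 (lc (embed_S1 a * u)) * phi - embed_S1 (lc phi) * (embed_S1 a * u) =
    embed_S1 a * (embed_S1 (lc u) * phi - embed_S1 (lc phi) * u).
  by rewrite coef_uni_embedM rmorphM; ring.
by apply: S1_span_gen; apply: G_swap.
Qed.

Definition lc_ideal s a : Prop := exists2 f, span s f & lc f = a.

Lemma lc_ideal_ideal s : ideal (lc_ideal s).
Proof.
split.
- by exists 0; [apply: S1_span0 | rewrite rmorph0 coef0].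
- move=> _ _ [f sf <-] [g sg <-]; exists (f + g); first exact: S1_spanD.
  by rewrite rmorphD coefD.
- move=> a _ [f sf <-]; exists (embed_S1 a * f); first exact: S1_spanM.
  exact: coef_uni_embedM.
Qed.

Lemma lc_ideal_cons phi s a : lc_ideal s a -> lc_ideal (phi :: s) a.
Proof.
case=> f sf fa; exists f => //; apply: S1_span_mono sf => g gs.
by rewrite inE gs orbT.
Qed.

Lemma lc_ideal_head phi s : lc_ideal (phi :: s) (lc phi).
Proof. by exists phi => //; apply: S1_span_id; rewrite inE eqxx. Qed.

(** An ideal generated by linear forms is the kernel of a substitution sigma by
    linear forms, which parametrizes its zero space. *)
Definition unit_or_linear s : Prop := lc_ideal s 1 \/
  exists sigma : n.-tuple {mpoly k[n]},
    [/\ forall i, tnth sigma i \is 1.-homog,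
        forall a, lc_ideal s a -> a \mPo sigma = 0
      & forall i, lc_ideal s ('X_i - tnth sigma i)].

Lemma unit_or_linear_prime s a b : unit_or_linear s ->
  lc_ideal s (a * b) -> lc_ideal s a \/ lc_ideal s b.
Proof.
have iK := lc_ideal_ideal s; have [_ _ KM] := iK.
case=> [K1 _|[sigma [_ sK Ks]] /sK/eqP]; first by left; rewrite -[a]mulr1; apply: KM.
have ker c : c \mPo sigma = 0 -> lc_ideal s c.
  by move=> c0; rewrite -[c]subr0 -c0; apply: comp_mpoly_mod.
by rewrite rmorphM mulf_eq0 => /orP[/eqP/ker|/eqP/ker]; [left | right].
Qed.

(** A new linear form h = sigma (lc phi), if nonzero, is used to eliminate one
    more variable from sigma. *)
Lemma unit_or_linear_cons phi s : G phi -> unit_or_linear s ->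
  unit_or_linear (phi :: s).
Proof.
move=> [Kphi [e le_e phih]].
have iK := lc_ideal_ideal s; have [_ KD KM] := iK.
have iK' := lc_ideal_ideal (phi :: s); have [_ KD' KM'] := iK'.
case=> [K1|[sigma [sh sK Ks]]]; first by left; apply: lc_ideal_cons.
have [Kl|nKl] := classic (lc_ideal s (lc phi)).
  right; exists sigma; split=> // [a [f /span_cons[b [f0 [sf0 ->]]] <-]|i].
    rewrite rmorphD coefD coef_uni_embedM; apply: sK.
    by apply: KD; [apply: KM | exists f0].
  exact: lc_ideal_cons.
have lh : lc phi \is (e - t).-homog by apply: uni_homog.
have [lt|ge] := ltnP e t.
  by case: nKl; rewrite [lc phi](uni_homog0 phih lt); case: iK.
have e_le1 : (e - t <= 1)%N by rewrite leq_subLR addn1.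
move: lh; case: (e - t)%N e_le1 => [|[|//]] _ lh.
  left; have phi0 := homog0E lh.
  have nz : (lc phi)@_0%MM != 0.
    apply/eqP => e0; case: nKl; rewrite phi0 e0 mpolyC0; by case: iK.
  have -> : 1 = ((lc phi)@_0%MM)^-1%:MP * lc phi.
    by rewrite {2}phi0 -mpolyCM mulVf // mpolyC1.
  by apply: KM'; apply: lc_ideal_head.
pose h := lc phi \mPo sigma.
have hh : h \is 1.-homog by apply: linear_comp_homog.
have h_mod : lc_ideal s (lc phi - h) by apply: comp_mpoly_mod.
have hn0 : h != 0.
  by apply: contra_notN nKl => /eqP h0; move: h_mod; rewrite h0 subr0.
have [i hi] : exists i, h@_U_(i) != 0.
  have := mlead_supp hn0; rewrite mcoeff_msupp.
  have /eqP/mdeg1P[i /eqP ->] : mdeg (mlead h) = 1%N.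
    by move/dhomogP: hh; apply; apply: mlead_supp.
  by move=> hi; exists i.
have h0 : h \mPo elim_var i h = 0.
  by rewrite elim_varE // divff // scale1r subrr.
right; exists [tuple (tnth sigma j \mPo elim_var i h) | j < n].
split=> [j|_ [f /span_cons[b [f0 [sf0 ->]]] <-]|j].
- rewrite tnth_mktuple elim_varE // rpredB //; exact: rpredZ.
- rewrite -comp_mpolyA rmorphD coefD coef_uni_embedM !rmorphD !rmorphM /=.
  rewrite [lc f0 \mPo _]sK; last by exists f0.
  by rewrite -/h h0 mulr0 rmorph0 addr0.
rewrite tnth_mktuple elim_varE //.
have -> : 'X_j - (tnth sigma j - ((tnth sigma j)@_U_(i) / h@_U_(i)) *: h) =
   ('X_j - tnth sigma j) + ((tnth sigma j)@_U_(i) / h@_U_(i)) *: h by ring.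
apply: KD'; first exact: lc_ideal_cons.
apply: idealZ => //; have -> : h = lc phi - (lc phi - h) by ring.
by apply: idealB => //; [apply: lc_ideal_head | apply: lc_ideal_cons].
Qed.

(** Adding phi to s, a syzygy a lc(phi) + .. = 0 is shortened in one of two
    ways.  If lc(phi) is in the ideal of s, then phi is replaced by its
    difference with an element of the span of s having the same leading
    coefficient.  Otherwise a is in that ideal, which is prime or the unit
    ideal, and Koszul syzygies remove the term of phi. *)
Lemma syzygies_span s : (forall g, g \in s -> G g) ->
  unit_or_linear s /\ (forall f, span s f -> lc f = 0 -> S1_span G2 f).
Proof.
elim: s => [|phi s IHs] sG.
  split=> [|f sf _]; last first.
    by apply: S1_span_mono sf => g; rewrite in_nil.
  have nil0 f : span [::] f -> f = 0.
    by move/(_ (fun f => f = 0)); apply=> // u v -> ->; rewrite addr0.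
  right; exists [tuple 'X_i | i < n]; split=> [i|_ [f /nil0 -> <-]|i].
  - by rewrite tnth_mktuple dhomogX /= mdeg1.
  - by rewrite rmorph0 coef0 rmorph0.
  - by rewrite tnth_mktuple subrr; case: (lc_ideal_ideal [::]).
have sG' : forall g, g \in s -> G g by move=> g gs; apply: sG; rewrite inE gs orbT.
have [ul IH] := IHs sG'.
have Gphi : G phi by apply: sG; rewrite inE eqxx.
split; first exact: unit_or_linear_cons.
move=> f /span_cons[a [f0 [sf0 ->]]] fl.
have f0l : lc f0 = - (a * lc phi).
  by apply/eqP; rewrite -addr_eq0 addrC -coef_uni_embedM -coefD -rmorphD fl.
have iK := lc_ideal_ideal s.
have : lc_ideal s (a * lc phi).
  rewrite -[a * _]opprK -f0l; apply: idealN => //; by exists f0.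
case/(unit_or_linear_prime ul) => [[psi spsi psia]|[psi spsi psil]].
  have -> : embed_S1 a * phi + f0 =
    (embed_S1 (lc psi) * phi - embed_S1 (lc phi) * psi)
    + (f0 + embed_S1 (lc phi) * psi) by rewrite psia; ring.
  apply: S1_spanD; first exact: span_swap sG' Gphi spsi.
  apply: IH; first by apply: S1_spanD => //; apply: S1_spanM.
  by rewrite rmorphD coefD coef_uni_embedM f0l psia; ring.
have [Kphi [e le_e phih]] := Gphi.
have psi'l : lc (hcomp e psi) = lc phi.
  by rewrite uni_hcomp psil -{2}(pihomog_dE phih) -/(hcomp e phi) uni_hcomp.
have -> : embed_S1 a * phi + f0 =
   embed_S1 a * (phi - hcomp e psi) + (f0 + embed_S1 a * hcomp e psi) by ring.
apply: S1_spanD.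
  apply: S1_span_gen; split; last first.
    exists e; first exact: leqW.
    by rewrite rpredB //; apply: pihomogP.
  apply: elim_module_lower; last by rewrite rmorphB coefB psi'l subrr.
  by apply: elim_moduleB => //; apply: (span_elim sG'); apply: span_hcomp.
apply: IH; first by apply: S1_spanD => //; apply: S1_spanM; apply: span_hcomp.
by rewrite rmorphD coefD coef_uni_embedM f0l psi'l addNr.
Qed.

Lemma second_elim_span f : elim_module I t f -> S1_span G2 f.
Proof.
move=> [If sf].
have /S1_span_finite[s sG spf] : S1_span G f.
  by apply: K_span; split=> //; apply: leqW.
have [_ syz] := syzygies_span sG.
by apply: syz => //; apply: (leq_sizeP _ _ sf).
Qed.

End SecondElim.

(** * Comparison of I with the ideal of X *)

Section Chart.
Variables (k : fieldType) (n : nat).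
Implicit Types (f g : {mpoly k[n.+1]}) (A B : {mpoly k[n.+1]} -> Prop).

Definition mremove (j : 'I_n.+1) (t : 'X_{1..n.+1}) : 'X_{1..n} :=
  [multinom t (lift j l) | l < n].

Lemma mdeg_mremove j (t : 'X_{1..n.+1}) : mdeg t = (t j + mdeg (mremove j t))%N.
Proof.
rewrite !mdegE (bigD1_ord j) //=; congr (_ + _)%N; apply: eq_bigr => l _.
by rewrite mnmE.
Qed.

Lemma mremove_inj j (t u : 'X_{1..n.+1}) : mdeg t = mdeg u -> mremove j t = mremove j u -> t = u.
Proof.
move=> dtu rtu; apply/mnmP => i; case: (unliftP j i) => [l|] ->.
  by have := congr1 (fun m : 'X_{1..n} => m l) rtu; rewrite !mnmE.
by apply/eqP; rewrite -(eqn_add2r (mdeg (mremove j t))) -mdeg_mremove dtu rtu -mdeg_mremove.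
Qed.

Lemma dehomogXj (j : 'I_n.+1) : dehomog j ('X_j : {mpoly k[n.+1]}) = 1.
Proof. by rewrite /dehomog comp_mpolyXU -tnth_nth tnth_mktuple unlift_none. Qed.

Lemma dehomogX j (t : 'X_{1..n.+1}) :
  'X_[t] \mPo [tuple if unlift j i is Some l then 'X_l else 1 | i < n.+1]
  = 'X_[mremove j t] :> {mpoly k[n]}.
Proof.
rewrite comp_mpolyX (bigD1_ord j) //= tnth_mktuple unlift_none expr1n mul1r.
rewrite mpolyXE_id; apply: eq_bigr => l _.
by rewrite tnth_mktuple liftK mnmE.
Qed.

(** On forms of a fixed degree the exponent of x_j is determined by the other
    ones. *)
Lemma dehomog_eq0 j m f : f \is m.-homog -> dehomog j f = 0 -> f = 0.
Proof.
move=> fh f0; apply/mpolyP => u; rewrite mcoeff0.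
have [uf|/memN_msupp_eq0 //] := boolP (u \in msupp f).
have := congr1 (mcoeff (mremove j u)) f0; rewrite mcoeff0 /dehomog comp_mpolyEX.
rewrite linear_sum /= (bigD1_seq u) //= dehomogX mcoeffZ mcoeffX eqxx mulr1.
rewrite big_seq_cond big1 ?addr0 // => t /andP[tf ne].
rewrite dehomogX mcoeffZ mcoeffX; case: eqP => [e|_]; last by rewrite mulr0.
case/eqP: ne; apply: (mremove_inj _ e).
by have /dhomogP h := fh; rewrite !h.
Qed.

(** Equality of f / x_j^m with a section f' / x_j^m' of B, cleared of
    denominators. *)
Lemma chart_transfer A B j m f : ideal B ->
  (forall g : {mpoly k[n]}, sheaf_on_chart A j g -> sheaf_on_chart B j g) ->
  A f -> f \is m.-homog -> exists N, B ('X_j ^+ N * f).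
Proof.
move=> [_ _ BM] AB Af fh.
have [|m' [f' [Bf' fh' e]]] := AB (dehomog j f); first by exists m, f.
exists m'; suff -> : 'X_j ^+ m' * f = 'X_j ^+ m * f' by apply: BM.
apply/eqP; rewrite -subr_eq0; apply/eqP; apply: (@dehomog_eq0 j (m' + m)).
  by rewrite rpredB //; [|rewrite addnC]; apply: dhomogM => //; apply: Xn_homog.
move: e (dehomogXj j); rewrite /dehomog rmorphB !rmorphM !rmorphXn /= => -> ->.
by rewrite !expr1n !mul1r subrr.
Qed.

Lemma defines_sub (X : proj_scheme k n) I f : homogeneous_ideal I ->
  defines_scheme_theoretically I X -> I f -> X f.
Proof.
move=> [iI I_hom] IX If; have [iX X_hom] := ideal_of_homogeneous X.
apply: (homogeneous_idealE (conj iX X_hom)) => m.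
apply: ideal_of_saturated.
have /fin_all_exists [N NP] : forall j : 'I_n.+1, exists N, X ('X_j ^+ N * hcomp m f).
  move=> j; apply: (@chart_transfer I X j m) => //; last exact: pihomogP.
    by move=> g /IX.
  exact: I_hom.
exists (\max_j N j) => j.
rewrite -(subnK (leq_bigmax j : N j <= _)%N) exprD -mulrA.
by case: iX => _ _; apply.
Qed.

Lemma defines_power (X : proj_scheme k n) I f j : homogeneous_ideal I ->
  defines_scheme_theoretically I X -> X f -> exists N, I ('X_j ^+ N * f).
Proof.
move=> [iI I_hom] IX Xf; have [iX X_hom] := ideal_of_homogeneous X.
have /fin_all_exists [N NP] : forall m : 'I_(msize f), exists N, I ('X_j ^+ N * hcomp m f).
  move=> m; apply: (@chart_transfer X I j m) => //; last exact: pihomogP.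
    by move=> g /IX.
  exact: X_hom.
exists (\max_m N m); move: (\max_m N m) (fun m => leq_bigmax m : N m <= \max_m N m)%N.
move=> M NM; rewrite (hcomp_sum f) mulr_sumr.
apply: ideal_sum => // m _.
rewrite -(subnK (NM m)) exprD -mulrA.
by case: iI => _ _; apply.
Qed.

Lemma restrict_lineE (y : 'rV[k]_n) f :
  restrict_line y f = map_poly (meval (fun j => y 0 j)) (uni f).
Proof.
rewrite /restrict_line uniE /mmap rmorph_sum; apply: eq_bigr => t _.
rewrite rmorphM /= map_polyC /= mevalC /mmap1 rmorph_prod; congr (_ * _).
apply: eq_bigr => i _; rewrite rmorphXn /= /uni_var.
by case: unliftP => [j|] _; rewrite ?map_polyC ?map_polyX //= mevalXU.
Qed.

Lemma restrict_line_eval (x : 'rV[k]_n.+1) f :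
  (restrict_line (lin_proj x) f).[x 0 ord0] = f.@[fun i => x 0 i].
Proof.
rewrite /restrict_line /mmap mevalE horner_sum; apply: eq_bigr => t _.
rewrite hornerM hornerC /mmap1 horner_prod; congr (_ * _); apply: eq_bigr => i _.
rewrite horner_exp; case: (unliftP ord0 i) => [j|] ->.
  by rewrite hornerC mxE.
by rewrite hornerX.
Qed.

End Chart.

(** * A monic form of degree d *)

Section Center.
Variables (k : fieldType) (n : nat).

Lemma eval_center_neq0 (f : {mpoly k[n.+1]}) :
  f.@[fun i => proj_center k n 0 i] != 0 -> exists i, f@_(mcons i 0%MM) != 0.
Proof.
move=> fq; apply: NNPP => nex; case/eqP: fq; rewrite mevalE big1_seq // => t /= _.
have [t0|] := eqVneq (mtail t) 0%MM.
  have [->|ne] := eqVneq f@_t 0; first by rewrite mul0r.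
  by case: nex; exists (t ord0); rewrite -t0 -mcons_tail.
rewrite -mdeg_eq0 mdegE sum_nat_eq0 negb_forall => /existsP[j].
rewrite mnmE /= => tj; rewrite (bigD1 (lift ord0 j)) //= mxE eqxx.
by rewrite eq_sym (negbTE (neq_lift _ _)) expr0n (negbTE tj) mul0r mulr0.
Qed.

End Center.

Section Monic.
Variables (k : fieldType) (n d : nat) (I : {mpoly k[n.+1]} -> Prop).
Hypothesis I_hom : homogeneous_ideal I.
Hypothesis gen_le : forall m f, (d <= m)%N -> I f -> f \is m.+1.-homog ->
  var_comb (enum 'I_n.+1) I f.

Let has_x0_power m := exists f, [/\ I f, f \is m.-homog & f@_(mcons m 0%MM) != 0].

(** Only the term x_0 h_0 of f = sum x_i h_i contributes to the power of x_0. *)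
Lemma has_x0_power_step m : (d <= m)%N -> has_x0_power m.+1 -> has_x0_power m.
Proof.
move=> dm [f [If fh fc]]; have [h Ih fE] := gen_le dm If fh.
exists (hcomp m (h ord0)); split; [by case: I_hom => _; apply | exact: pihomogP |].
rewrite mcoeff_hcomp mdeg_mcons mdeg0 addn0 eqxx.
move: fc; rewrite fE -!mcoeff_uni rmorph_sum big_enum big_ord_recl coefD mcoeffD.
rewrite rmorphM /= uniX0 coefXM /= coef_sum linear_sum big1 ?addr0 // => j _ /=.
by rewrite rmorphM /= uniXlift coefCM mcoeff0_Xmul.
Qed.

Lemma has_x0_power_up m e : has_x0_power m -> has_x0_power (e + m).
Proof.
case=> f [If fh fc]; exists ('X_ord0 ^+ e * f); split.
- by case: I_hom => [[_ _ IM] _]; apply: IM.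
- by apply: dhomogM => //; apply: Xn_homog.
- rewrite -mcoeff_uni rmorphM rmorphXn /= uniX0 coefXnM ltnNge leq_addr /= addKn.
  by rewrite mcoeff_uni.
Qed.

Lemma monic_of_point_notin f : I f ->
  f.@[fun i => proj_center k n 0 i] != 0 ->
  exists F, [/\ I F, F \is d.-homog & (uni F)`_d = 1].
Proof.
move=> If /eval_center_neq0[m fm].
have : has_x0_power m.
  exists (hcomp m f); split; [by case: I_hom => _; apply | exact: pihomogP |].
  by rewrite mcoeff_hcomp mdeg_mcons mdeg0 addn0 eqxx.
move/(has_x0_power_up d); elim: m {fm} => [|m IHm]; last first.
  by rewrite addnS => /has_x0_power_step-/(_ (leq_addr _ _))/IHm.
rewrite addn0 => -[g [Ig gh gc]].
exists ((g@_(mcons d 0%MM))^-1 *: g); split.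
- by apply: idealZ => //; case: I_hom.
- exact: rpredZ.
rewrite uniZ coefZ; have /homog0E -> : (uni g)`_d \is 0.-homog.
  by have := uni_homog d gh; rewrite subnn.
by rewrite mcoeff_uni -mpolyCM mulVf // mpolyC1.
Qed.

End Monic.

(** * Ideals of k[t], linear loci and cut-out loci *)

Section Colength.
Variables (k : fieldType) (A : {poly k} -> Prop).
Hypotheses (AD : forall f g, A f -> A g -> A (f + g)) (AM : forall q f, A f -> A (q * f)).

(** If A contains a nonzero g of degree e < m, then the residues modulo g of any
    m polynomials lie in a space of dimension e and are dependent; if A contains
    no such g, then 1, t, .., t^(m-1) are independent modulo A. *)
Lemma colength_geP m : colength_ge A m <->
  forall g, A g -> (size g <= m)%N -> g = 0.
Proof.
split=> [[v vP] g Ag sg | small].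
  apply/eqP/negPn/negP => nz.
  pose M := \matrix_(i < m, j < (size g).-1) (v i %% g)`_j.
  have sg0 : (0 < size g)%N by rewrite size_poly_gt0.
  have : kermx M != 0.
    rewrite kermx_eq0 /row_free; apply/eqP => rM.
    by have := rank_leq_col M; rewrite rM leqNgt prednK // sg.
  case/rowV0Pn => c /sub_kermxP cM cn0.
  have cv : (\sum_i c 0 i *: v i) %% g = 0.
    have -> : (\sum_i c 0 i *: v i) %% g = \sum_i c 0 i *: (v i %% g).
      elim: (index_enum _) => [|i s IHs]; first by rewrite !big_nil mod0p.
      by rewrite !big_cons modpD modpZl IHs.
    apply/polyP => j; rewrite coef0 coef_sum.
    have [lt|ge] := ltnP j (size g).-1.
      have /rowP/(_ (Ordinal lt)) := cM; rewrite !mxE => cj.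
      by rewrite -[RHS]cj; apply: eq_bigr => i _; rewrite coefZ mxE.
    rewrite big1 // => i _; rewrite coefZ nth_default ?mulr0 //.
    by rewrite (leq_trans _ ge) // -ltnS prednK // ltn_modp.
  have Acv : A (\sum_i c 0 i *: v i).
    by rewrite (divp_eq (\sum_i c 0 i *: v i) g) cv addr0; apply: AM.
  case/eqP: cn0; apply/rowP => i; rewrite mxE; exact: (vP (fun i => c 0 i)).
exists (fun i => 'X^i) => c Ac i.
have coefc (j : nat) : (\sum_i c i *: 'X^i)`_j = if insub j is Some i then c i else 0.
  rewrite coef_sum; case: insubP => [u _ uj|nj].
    rewrite (bigD1 u) //= coefZ coefXn uj eqxx mulr1 big1 ?addr0 // => v ne.
    rewrite coefZ coefXn -uj; case: eqP => [e|_]; last by rewrite mulr0.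
    by case/eqP: ne; apply/val_inj.
  rewrite big1 // => v _; rewrite coefZ coefXn.
  case: eqP => [e|_]; last by rewrite mulr0.
  by rewrite e ltn_ord in nj.
have /small c0 : (size (\sum_i c i *: 'X^i)%R <= m)%N.
  apply/leq_sizeP => j le; rewrite coefc; case: insubP => // u.
  by rewrite ltnNge le.
have := coefc i; rewrite c0 // coef0 insubT //= => cl ->.
by congr c; apply/val_inj.
Qed.

End Colength.

(** A nonzero element of least degree divides all of A and is not constant, so
    it has a root. *)
Lemma common_root (k : closedFieldType) (A : {poly k} -> Prop) (g0 : {poly k}) :
  (forall f g, A f -> A g -> A (f + g)) -> (forall q f, A f -> A (q * f)) ->
  A g0 -> g0 != 0 -> (forall g, A g -> (size g <= 1)%N -> g = 0) ->
  exists x, forall g, A g -> root g x.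
Proof.
move=> AD AM; move: {2}(size g0) (leqnn (size g0)) => m.
elim: m g0 => [|m IHm] g0 le Ag0 nz no_const.
  by rewrite leqn0 size_poly_eq0 (negbTE nz) in le.
have [[g [Ag ng lt]]|min] := classic (exists g, [/\ A g, g != 0 & (size g < size g0)%N]).
  by apply: (IHm g) => //; rewrite -ltnS (leq_trans lt).
have /closed_rootP[x gx] : size g0 != 1%N.
  by apply: contraNneq nz => s1; rewrite (no_const g0) // s1.
exists x => g Ag; have [g0g|ng] := eqVneq (g %% g0) 0.
  by rewrite (divp_eq g g0) g0g addr0 rootM gx orbT.
case: min; exists (g %% g0); split=> //; last by rewrite ltn_modp.
have -> : g %% g0 = g + (- (g %/ g0)) * g0.
  by rewrite {2}(divp_eq g g0); ring.
by apply: AD => //; apply: AM.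
Qed.

(** A subspace given by a predicate, as a subspace given by a basis: adjoin
    vectors until the dimension cannot grow. *)
Lemma pred_vspace (k : fieldType) (V : vectType k) (P : V -> Prop) :
  P 0 -> (forall a u v, P u -> P v -> P (a *: u + v)) ->
  exists W : {vspace V}, forall v, P v <-> v \in W.
Proof.
move=> P0 PL.
have maximal (W : {vspace V}) : (forall v, v \in W -> P v) ->
    ~ (exists v, P v /\ v \notin W) -> exists W : {vspace V}, forall v, P v <-> v \in W.
  move=> WP max; exists W => v; split=> [Pv|/WP//].
  by apply: NNPP => /negP nv; case: max; exists v.
suff ext m : forall W : {vspace V}, (forall v, v \in W -> P v) ->
    (\dim {:V} - \dim W <= m)%N -> exists W : {vspace V}, forall v, P v <-> v \in W.
  by apply: (ext _ 0%VS) => // v; rewrite memv0 => /eqP ->.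
elim: m => [|m IHm] W WP le;
  have [[v [Pv nv]]|/(maximal W WP)//] := classic (exists v, P v /\ v \notin W).
  have WT : W = fullv by apply/eqP; rewrite eqEdim subvf -subn_eq0 -leqn0.
  by rewrite WT memvf in nv.
apply: (IHm (W + <[v]>)%VS) => [u /memv_addP[w wW [u' /vlineP[a ->] ->]]|].
  by rewrite addrC; apply: PL => //; apply: WP.
have lt : (\dim W < \dim (W + <[v]>))%N.
  rewrite ltn_neqAle dimvS ?addvSl // andbT.
  apply: contraNneq nv => e.
  have /eqP -> : W == (W + <[v]>)%VS by rewrite eqEdim addvSl e leqnn.
  by rewrite memvE addvSr.
rewrite leq_subLR in le; rewrite leq_subLR (leq_trans le) //.
by rewrite addnS -addSn leq_add2r.
Qed.

Section ZeroLocus.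
Variables (k : fieldType) (n : nat).
Implicit Types (K : {mpoly k[n]} -> Prop) (y : 'rV[k]_n).

Definition ev y (f : {mpoly k[n]}) := f.@[fun i => y 0 i].

Lemma vanish_generated K m y : generated_in_degrees_le K m ->
  (forall e f, (e <= m)%N -> f \is e.-homog -> K f -> ev y f = 0) ->
  forall f, K f -> ev y f = 0.
Proof.
move=> [G [Gm KG]] small f /KG/(_ (fun f => ev y f = 0)); apply.
  rewrite /ev; split=> [|u v u0 v0|a u u0]; first exact: meval0.
    by rewrite mevalD u0 v0 addr0.
  by rewrite mevalM u0 mulr0.
move=> g Gg; have [e le gh] := Gm g Gg; apply: (small e) => //.
by apply/KG => A _; apply.
Qed.

(** If Z has a point, then K has no nonzero constant and its zeros are those of
    its linear forms. *)
Lemma zeros_linear K (Z : 'rV[k]_n -> Prop) : generated_in_degrees_le K 1 ->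
  (forall y, Z y -> y != 0) ->
  (forall y, y != 0 -> (Z y <-> forall f, K f -> ev y f = 0)) ->
  empty_locus Z \/ linear_locus Z.
Proof.
move=> Kgen Z0 ZK; have [[y0 Zy0]|nZ] := classic (exists y, Z y); last first.
  by left=> y Zy; case: nZ; exists y.
right.
have linear_ev (f : {mpoly k[n]}) y : f \is 1.-homog -> ev y f = \sum_j f@_U_(j) * y 0 j.
  move=> fh; rewrite /ev {1}(linear_formE fh) linear_sum; apply: eq_bigr => j _ /=.
  by rewrite mevalZ mevalXU.
have [||W WP] := @pred_vspace k _ (fun y => forall f, K f -> f \is 1.-homog -> ev y f = 0).
- move=> f _ fh; rewrite linear_ev // big1 // => j _; by rewrite mxE mulr0.
- move=> a u v Pu Pv f Kf fh; rewrite linear_ev //.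
  have -> : \sum_j f@_U_(j) * (a *: u + v) 0 j = a * ev u f + ev v f.
    rewrite !linear_ev // mulr_sumr -big_split; apply: eq_bigr => j _ /=.
    by rewrite !mxE; ring.
  by rewrite Pu // Pv // mulr0 addr0.
have ZW y : y != 0 -> (Z y <-> y \in W).
  move=> y_n0; apply: (iff_trans (ZK y y_n0)); apply: (iff_trans _ (WP y)).
  split=> [h f Kf _|h]; first exact: h.
  apply: (vanish_generated Kgen) => -[|[|//]] f _ fh Kf; last exact: h.
  have := (ZK y0 (Z0 _ Zy0)).1 Zy0 f Kf.
  by rewrite (homog0E fh) /ev !mevalC.
exists W => //; rewrite lt0n dimv_eq0.
apply/eqP => W0; have := (ZW _ (Z0 _ Zy0)).1 Zy0.
by rewrite W0 memv0 (negbTE (Z0 _ Zy0)).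
Qed.

End ZeroLocus.

(** The forms of K of a given degree e <= m make up a finite-dimensional space;
    the equations are bases of these spaces. *)
Lemma zeros_cut_out (k : fieldType) (n m : nat) (K : {mpoly k[n]} -> Prop)
    (Z : 'rV[k]_n -> Prop) : ideal K -> generated_in_degrees_le K m ->
  (forall y, y != 0 -> (Z y <-> forall f, K f -> ev y f = 0)) ->
  cut_out_in_degrees_le Z m.
Proof.
case: n K Z => [|n] K Z iK Kgen ZK.
  by exists [::] => // y; rewrite [y]thinmx0 eqxx.
have /fin_all_exists [W WP] : forall e : 'I_m.+1, exists W : {vspace dhomog n.+1 k e},
    forall f, K (val f) <-> f \in W.
  move=> e; apply: (pred_vspace (P := fun f : dhomog n.+1 k e => K (val f))).
    by case: iK.
  move=> a u v Ku Kv; rewrite -[val _]/(mpoly_of_dhomog _) linearP.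
  by case: (iK) => _ KD _; apply: KD => //; apply: idealZ.
pose basis (e : 'I_m.+1) := [seq val f | f <- (vbasis (W e) : seq (dhomog n.+1 k e))].
pose s := flatten [seq basis e | e <- enum 'I_m.+1].
exists s => [f /flatten_mapP[e _ /mapP[g _ ->]]|y y0].
  by exists e; [rewrite -ltnS | apply: dhomog_is_dhomog].
apply: (iff_trans (ZK y y0)); split=> [h f|h].
  case/flatten_mapP => e _ /mapP[g gW ->]; apply: h; apply/WP.
  exact: vbasis_mem.
apply: (vanish_generated Kgen) => e f le fh Kf.
have lt : (e < m.+1)%N by [].
pose g : dhomog n.+1 k (Ordinal lt) := DHomog fh.
have /WP/coord_vbasis gE : K (val g) by [].
rewrite -[f]/(val g) gE /ev linear_sum /= linear_sum big1 // => i _.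
rewrite linearZ /=; set b := _`_i; suff -> : (mpoly_of_dhomog b).@[fun j => y 0 j] = 0 by rewrite mulr0.
apply: h.
apply/flatten_mapP; exists (Ordinal lt); first by rewrite mem_enum.
by apply/map_f/mem_nth; rewrite size_tuple.
Qed.

(** * The loci of long fibres *)

Section MultipleLocus.
Variables (k : closedFieldType) (n d : nat) (X : proj_scheme k n).
Variable I : {mpoly k[n.+1]} -> Prop.
Hypotheses (I_hom : homogeneous_ideal I) (I_defines_X : defines_scheme_theoretically I X).
Variable F : {mpoly k[n.+1]}.
Hypotheses (I_F : I F) (F_homog : F \is d.-homog) (F_monic : (uni F)`_d = 1).
Implicit Types (y : 'rV[k]_n) (f : {mpoly k[n.+1]}).

Let iI : ideal I. Proof. by case: I_hom. Qed.
Let iX : ideal X. Proof. by case: (ideal_of_homogeneous X). Qed.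

Lemma restrict_lineM y f g : restrict_line y (f * g) = restrict_line y f * restrict_line y g.
Proof. by rewrite !restrict_lineE !rmorphM. Qed.

Lemma restrict_lineB y f g : restrict_line y (f - g) = restrict_line y f - restrict_line y g.
Proof. by rewrite !restrict_lineE !rmorphB. Qed.

Lemma restrict_lineD y f g : restrict_line y (f + g) = restrict_line y f + restrict_line y g.
Proof. by rewrite !restrict_lineE !rmorphD. Qed.

Lemma restrict_lineX y e : restrict_line y ('X_ord0 ^+ e) = 'X^e.
Proof. by rewrite restrict_lineE rmorphXn /= uniX0 rmorphXn /= map_polyX. Qed.

Lemma restrict_embed y a : restrict_line y (embed_S1 a) = (ev y a)%:P.
Proof. by rewrite restrict_lineE uni_embed map_polyC. Qed.

Lemma restrict_surj y (p : {poly k}) : exists q, restrict_line y q = p.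
Proof.
exists (\sum_(i < size p) (p`_i)%:MP * 'X_ord0 ^+ i).
rewrite restrict_lineE !rmorph_sum -[RHS]coefK poly_def; apply: eq_bigr => i _.
by rewrite !rmorphM !rmorphXn /= uniC uniX0 map_polyC /= mevalC map_polyX mul_polyC.
Qed.

Lemma coef_restrict y f i : (restrict_line y f)`_i = ev y (uni f)`_i.
Proof. by rewrite restrict_lineE coef_map. Qed.

Lemma size_restrict y f e : (size (uni f) <= e)%N -> (size (restrict_line y f) <= e)%N.
Proof.
move=> /leq_sizeP sf; apply/leq_sizeP => j /sf fj.
by rewrite coef_restrict fj /ev meval0.
Qed.

Lemma fibre_idealD y g h : fibre_ideal X y g -> fibre_ideal X y h -> fibre_ideal X y (g + h).
Proof.
move=> [f Xf ->] [f' Xf' ->]; exists (f + f'); last by rewrite restrict_lineD.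
by case: iX => _ + _; apply.
Qed.

Lemma fibre_idealM y q g : fibre_ideal X y g -> fibre_ideal X y (q * g).
Proof.
move=> [f Xf ->]; have [p <-] := restrict_surj y q; exists (p * f).
  by case: iX => _ _; apply.
by rewrite restrict_lineM.
Qed.

(** Each element of the ideal of X is carried into I by a power of a variable
    that is nonzero at y, and this power restricts to a nonzero constant. *)
Lemma fibre_idealE y g : y != 0 -> fibre_ideal X y g <-> exists2 f, I f & g = restrict_line y f.
Proof.
move=> y0; split=> [[f Xf ->]|[f If ->]]; last first.
  by exists f => //; apply: (defines_sub I_hom I_defines_X).
have [j yj] : exists j, y 0 j != 0.
  apply: NNPP => nex; case/eqP: y0; apply/rowP => j; rewrite mxE; apply/eqP/negPn/negP => yj.
  by case: nex; exists j.
have [N IN] := defines_power (lift ord0 j) I_hom I_defines_X Xf.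
exists (((y 0 j) ^- N)%:MP * ('X_(lift ord0 j) ^+ N * f)).
  by case: iI => _ _; apply.
rewrite !restrict_lineE !rmorphM rmorphXn /= uniC uniXlift rmorphXn /= !map_polyC /=.
by rewrite mevalC mevalXU mulrA -polyC_exp -polyCM mulVf ?expf_neq0 // mul1r.
Qed.

Lemma size_restrictF y : size (restrict_line y F) = d.+1.
Proof.
apply/eqP; rewrite eqn_leq; apply/andP; split.
  apply: size_restrict; apply/leq_sizeP => i lt; exact: (uni_homog0 F_homog).
rewrite ltnNge; apply/negP => /leq_sizeP/(_ _ (leqnn d))/eqP.
by rewrite coef_restrict F_monic /ev meval1 oner_eq0.
Qed.

(** A fibre of positive length has a point, since k is algebraically closed; so
    the condition that y lies in the image of X follows from the length. *)
Lemma multiple_locusP i y : y != 0 -> multiple_locus X i y <->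
  forall f, I f -> (size (restrict_line y f) <= i.+1)%N -> restrict_line y f = 0.
Proof.
move=> y0; have cP := @colength_geP _ _ (@fibre_idealM y) i.+1.
split=> [[_ /cP small] f If|small].
  by apply: small; apply/fibre_idealE => //; exists f.
have small' g : fibre_ideal X y g -> (size g <= i.+1)%N -> g = 0.
  by move/(fibre_idealE _ y0) => [f If ->]; apply: small.
split; last by apply/cP.
have Fy : fibre_ideal X y (restrict_line y F) by apply/fibre_idealE => //; exists F.
have Fn0 : restrict_line y F != 0 by rewrite -size_poly_eq0 size_restrictF.
have [|x xP] := common_root (@fibre_idealD y) (@fibre_idealM y) Fy Fn0.
  by move=> g Ag s1; apply: small' => //; apply: leq_trans s1 _.
pose p : 'rV[k]_n.+1 := \row_i (if unlift ord0 i is Some j then y 0 j else x).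
have py : lin_proj p = y by apply/rowP => j; rewrite !mxE liftK.
split=> //; exists p => //; split.
  apply: contraNneq y0 => p0; apply/eqP/rowP => j; rewrite -py p0 !mxE //.
move=> f Xf; rewrite -restrict_line_eval py mxE unlift_none.
by apply/rootP; apply: xP; exists f.
Qed.

Lemma multiple_locus_partial i y : y != 0 -> multiple_locus X i y ->
  forall a, partial_elim I i a -> ev y a = 0.
Proof.
move=> y0 /(multiple_locusP _ y0) small a /(partial_elimP I_hom)[f [If sf] <-].
by rewrite -coef_restrict small ?coef0 //; apply: size_restrict.
Qed.

Lemma shift_size y f i : (size (restrict_line y f) <= i.+1)%N -> restrict_line y f != 0 ->
  exists e, size (restrict_line y ('X_ord0 ^+ e * f)) = i.+1.
Proof.
move=> le nz; exists (i.+1 - size (restrict_line y f))%N.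
by rewrite restrict_lineM restrict_lineX mulrC size_mulXn // subnK.
Qed.

(** In f = q F + f', the quotient q vanishes on the line over y, because F
    restricts to a polynomial of degree d. *)
Lemma reduce_restrict y f : I f -> (size (restrict_line y f) <= d)%N ->
  exists2 f', elim_module I d f' & restrict_line y f' = restrict_line y f.
Proof.
move=> If sf; have [q [f' [fE sf' If']]] := divF I_hom I_F F_homog F_monic f.
exists f'; first by split=> //; apply: If'.
have rf : restrict_line y f = restrict_line y q * restrict_line y F + restrict_line y f'.
  by rewrite {1}fE restrict_lineD restrict_lineM.
rewrite rf; have [->|nz] := eqVneq (restrict_line y q) 0; first by rewrite mul0r add0r.
have Fn0 : restrict_line y F != 0 by rewrite -size_poly_eq0 size_restrictF.
have : (size (restrict_line y q * restrict_line y F)%R <= d)%N.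
  have -> : restrict_line y q * restrict_line y F = restrict_line y f - restrict_line y f'.
    by rewrite rf; ring.
  apply: (leq_trans (size_polyD _ _)); rewrite geq_max sf size_polyN.
  exact: size_restrict.
rewrite size_mul // size_restrictF addnS /= leqNgt -[ltnLHS]add0n ltn_add2r.
by rewrite size_poly_gt0 nz.
Qed.

(** A nonzero restriction of degree at most i = d - 1, shifted to degree i and
    reduced modulo F, comes from an element of x_0-degree at most i whose
    coefficient of x_0^i is nonzero at y. *)
Lemma multiple_locus_first i y : d = i.+1 -> y != 0 ->
  multiple_locus X i y <-> forall a, partial_elim I i a -> ev y a = 0.
Proof.
move=> di y0; split; first exact: multiple_locus_partial.
move=> zero; apply/multiple_locusP => // f If sf; apply/eqP/negPn/negP => nz.
have [e se] := shift_size sf nz.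
have [||f' Kf' f'E] := @reduce_restrict y ('X_ord0 ^+ e * f); rewrite ?se -?di //.
  by case: iI => _ _; apply.
have : restrict_line y ('X_ord0 ^+ e * f) == 0.
  rewrite -lead_coef_eq0 lead_coefE se -f'E coef_restrict; apply/eqP; apply: zero.
  by apply/(partial_elimP I_hom); exists f' => //; rewrite -di.
by rewrite -size_poly_eq0 se.
Qed.

(** If K_(i+1) vanishes at y, the previous case applies.  Otherwise some g in
    M_(i+2) has leading coefficient a with a(y) nonzero.  Reducing a restriction
    of degree i modulo F gives f' in M_(i+2) whose leading coefficient b
    vanishes at y, and a f' - b g lies in M_(i+1) with restriction a(y) times
    that of f'. *)
Lemma multiple_locus_second i y : d = i.+2 -> y != 0 ->
  multiple_locus X i y <-> forall a, partial_elim I i a -> ev y a = 0.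
Proof.
move=> di y0; split; first exact: multiple_locus_partial.
move=> zero; have [first|nfirst] := classic (forall a, partial_elim I i.+1 a -> ev y a = 0).
  have /(multiple_locusP _ y0) small := (multiple_locus_first di y0).2 first.
  by apply/multiple_locusP => // f If sf; apply: small => //; apply: leqW.
have [a [/(partial_elimP I_hom)[g [Ig sg] ga] ya]] :
    exists a, partial_elim I i.+1 a /\ ev y a != 0.
  apply: NNPP => nex; case: nfirst => a Ka; apply/eqP/negPn/negP => ya.
  by case: nex; exists a.
apply/multiple_locusP => // f If sf; apply/eqP/negPn/negP => nz.
have [e se] := shift_size sf nz.
have [||f' [If' sf'] f'E] := @reduce_restrict y ('X_ord0 ^+ e * f); rewrite ?se ?di //.
  by case: iI => _ _; apply.
pose b := (uni f')`_i.+1.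
have yb : ev y b = 0.
  rewrite -coef_restrict f'E; apply: (leq_sizeP _ i.+1) => //.
  by rewrite se.
pose h := embed_S1 a * f' - embed_S1 b * g.
have hE : restrict_line y h = ev y a *: restrict_line y ('X_ord0 ^+ e * f).
  rewrite restrict_lineB !(restrict_lineM _ (embed_S1 _)) !restrict_embed yb mul0r subr0.
  by rewrite f'E mul_polyC.
have : restrict_line y h == 0.
  have sh : size (restrict_line y h) = i.+1 by rewrite hE size_scale.
  rewrite -lead_coef_eq0 lead_coefE sh coef_restrict; apply/eqP; apply: zero.
  apply/(partial_elimP I_hom); exists h => //.
  apply: elim_module_lower; last first.
    by rewrite rmorphB coefB !coef_uni_embedM ga mulrC subrr.
  by apply: elim_moduleB => //; apply: elim_moduleM => //; split=> //; rewrite -di.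
by rewrite hE scaler_eq0 (negbTE ya) -size_poly_eq0 se.
Qed.

End MultipleLocus.

Theorem proposition3p9 (k : closedFieldType) (char0 : [pchar k] =i pred0)
    (n d : nat) (X : proj_scheme k n) (I : {mpoly k[n.+1]} -> Prop)
    (X_nondegenerate : scheme_nondegenerate X) (X_reduced : scheme_reduced X)
    (d_ge2 : (2 <= d)%N)
    (I_homogeneous : homogeneous_ideal I)
    (I_defines_X : defines_scheme_theoretically I X)
    (I_N_d2 : property_N d 2 I)
    (q_notin_X : ~ point_of X (proj_center k n)) :
  (generated_in_degrees_le (partial_elim I (d - 1)) 1
   /\ (empty_locus (multiple_locus X (d - 1))
       \/ linear_locus (multiple_locus X (d - 1))))
  /\
  (generated_in_degrees_le (partial_elim I (d - 2)) 3
   /\ (empty_locus (multiple_locus X (d - 2))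
       \/ cut_out_in_degrees_le (multiple_locus X (d - 2)) 3)).
Proof.
case: d d_ge2 I_N_d2 => [|[|t]] // _ [R torR]; rewrite subn1 subn2 /=.
have I_hom := I_homogeneous; have iI : ideal I by case: I_hom.
have gen_le m f : (t.+2 <= m)%N -> I f -> f \is m.+1.-homog ->
    var_comb (enum 'I_n.+1) I f.
  move=> dm; apply: (@tor1_generation _ _ _ I_hom R); apply: torR => //.
  by rewrite addn1 ltnS.
have reg_le m f : (t.+2 <= m)%N -> I f -> f \is m.+1.-homog ->
    var_comb (tail_vars n) I ('X_ord0 * f) -> var_comb (tail_vars n) I f.
  move=> dm If fh; apply: (@tor2_regularity _ _ _ I_hom R m) => //.
  - by apply: torR => //; rewrite addn2 !ltnS.
  - exact: uniq_tail_vars.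
  - exact: ord0_tail_vars.
  - exact: mem_tail_vars.
have [F [I_F F_homog F_monic]] : exists F, [/\ I F, F \is t.+2.-homog & (uni F)`_t.+2 = 1].
  have [f [Xf fq]] : exists f, X f /\ f.@[fun i => proj_center k n 0 i] != 0.
    apply: NNPP => nex; case: q_notin_X; split.
      apply/eqP => /rowP/(_ ord0)/eqP; by rewrite !mxE !eqxx oner_eq0.
    move=> f Xf; apply/eqP/negPn/negP => fq; case: nex; by exists f.
  have [N IN] := defines_power ord0 I_hom I_defines_X Xf.
  apply: (monic_of_point_notin I_hom gen_le IN).
  rewrite rmorphM rmorphXn /= mevalXU mxE !eqxx expr1n mul1r.
  exact: fq.
have first_span : forall f, elim_module I t.+2 f -> S1_span (elim_le I t.+2 t.+2) f.
  apply: elim_module_span => // m f.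
  exact: (elim_module_step I_hom reg_le I_F F_homog F_monic).
have gen1 : generated_in_degrees_le (partial_elim I t.+1) 1.
  by apply: partial_elim_generated => //; rewrite addn1.
have gen3 : generated_in_degrees_le (partial_elim I t) 3.
  by apply: partial_elim_generated => // f; rewrite addn3; apply: second_elim_span.
split; split=> //.
  apply: (zeros_linear gen1) => [y [[]]//|y y0].
  exact: (multiple_locus_first I_hom I_defines_X I_F F_homog F_monic).
right; apply: (zeros_cut_out _ gen3) => [|y y0]; first exact: partial_elim_ideal.
exact: (multiple_locus_second I_hom I_defines_X I_F F_homog F_monic).
Qed.
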